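(* The ideal $I_{2d}$ is a $GT$-system with group $D_{2d}$.
   Context: Let $k$ be an algebraically closed field of characteristic zero and $R=k[x_0,x_1,x_2]$ with its standard grading. Fix integers $d\ge 3$ and $0<a<\frac d2$ with $\gcd(a,d)=1$, a primitive $2d$-th root of unity $\varepsilon\in k$, and set $e=\varepsilon^2$. The dihedral group $D_{2d}=\langle \tau,\eta \mid \tau^d=\eta^2=(\eta\tau)^2=1\rangle$ of order $2d$ acts linearly on $R$ through the representation $\rho_a:D_{2d}\to \mathrm{GL}(3,k)$ with $\rho_a(\tau)=\mathrm{diag}(1,e^a,e^{d-a})$ and $\rho_a(\eta)$ the permutation matrix fixing $x_0$ and interchanging $x_1$ and $x_2$. Let $\Gamma=\langle \mathrm{diag}(1,e,e^{d-1})\rangle=\langle\rho_a(\tau)\rangle\subset\mathrm{GL}(3,k)$, with ring of invariants $R^\Gamma$. Let $\mathcal{B}_{2d}$ be the set consisting of: (i) the monomials $x_0^{2d-2i}x_1^ix_2^i$, $0\le i\le d$; and (ii) all binomials $x_0^{c_0}x_1^{c_1}x_2^{c_2}+x_0^{c_0}x_1^{c_2}x_2^{c_1}$ with $c_0+c_1+c_2=2d$, $c_1\neq c_2$ and $x_0^{c_0}x_1^{c_1}x_2^{c_2}\in R^{\Gamma}$. Let $I_{2d}\subset R$ be the homogeneous ideal generated by $\mathcal{B}_{2d}$ (equivalently, by all forms of degree $2d$ invariant under $D_{2d}$). Definitions. A homogeneous artinian ideal $I$ of a polynomial ring $k[x_0,\dots,x_n]=:P$ fails the weak Lefschetz property in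 degree $j-1$ if for every linear form $L$ (equivalently, a general one) the multiplication map $\times L:(P/I)_{j-1}\to(P/I)_j$ does not have maximal rank (is neither injective nor surjective). A Togliatti system is an artinian ideal $I\subset P$ generated by $r\le\binom{n+\delta-1}{n-1}$ forms of some degree $\delta$ which fails the weak Lefschetz property in degree $\delta-1$ (for $n=2$ the bound is $r\le \delta+1$). A covering of a variety $X$ is a variety $Y$ with a finite morphism $f:Y\to X$; $\mathrm{Aut}(f)$ is the group of automorphisms of $Y$ commuting with $f$; $f$ is a Galois covering with group $\mathrm{Aut}(f)$ if $\mathrm{Aut}(f)$ acts transitively on a fibre (hence on all fibres) of $f$. For a finite group $G$, a Togliatti system $I=(F_1,\dots,F_r)$ is a $GT$-system with group $G$ if the associated morphism $\varphi_I=(F_1:\dots:F_r):\mathbb{P}^n\to\mathbb{P}^{r-1}$, regarded as a morphism onto its image, is a Galois covering with group $G$. *)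

(* Defs.v *)
From HB Require Import structures.
From mathcomp Require Import all_boot all_order all_algebra.
From mathcomp Require Import all_fingroup all_solvable.
From mathcomp Require Import mpoly.

Set Implicit Arguments.
Unset Strict Implicit.
Unset Printing Implicit Defensive.

Import GRing.Theory.

Local Open Scope ring_scope.

Definition is_ideal (P : comNzRingType) (J : P -> Prop) : Prop :=
  [/\ J 0,
      (forall p q, J p -> J q -> J (p + q))
    & (forall c p, J p -> J (c * p))].

Definition ideal_gen (P : comNzRingType) (r : nat) (F : r.-tuple P) : P -> Prop :=
  fun p => exists c : 'I_r -> P, p = \sum_i c i * tnth F i.

(* The ring [P / I] is artinian: through the correspondence of ideals, the
   descending chain condition for the ideals of [P] that contain [I]. *)
Definition artinian_ideal (P : comNzRingType) (I : P -> Prop) : Prop :=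
  forall J : nat -> P -> Prop,
    (forall m, is_ideal (J m)) ->
    (forall m p, I p -> J m p) ->
    (forall m p, J m.+1 p -> J m p) ->
    exists N, forall m, (N <= m)%N -> forall p, J N p -> J m p.

(* Injectivity and surjectivity of multiplication by [L] from [(P/I)_j] to
   [(P/I)_(j+1)], for a homogeneous ideal [I]; the classes are represented by
   forms of degree [j] and [j+1]. *)
Definition mult_injective (k : fieldType) (n : nat)
    (I : {mpoly k[n]} -> Prop) (L : {mpoly k[n]}) (j : nat) : Prop :=
  forall f, f \is j.-homog -> I (L * f) -> I f.

Definition mult_surjective (k : fieldType) (n : nat)
    (I : {mpoly k[n]} -> Prop) (L : {mpoly k[n]}) (j : nat) : Prop :=
  forall g, g \is (j.+1).-homog ->
    exists2 f, f \is j.-homog & I (g - L * f).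

Definition fails_WLP_in_degree (k : fieldType) (n : nat)
    (I : {mpoly k[n]} -> Prop) (j : nat) : Prop :=
  forall L, L \is 1.-homog ->
    ~ mult_injective I L j /\ ~ mult_surjective I L j.

Definition Togliatti_system (k : fieldType) (n delta r : nat)
    (F : r.-tuple {mpoly k[n.+1]}) : Prop :=
  [/\ (forall i, tnth F i \is delta.-homog),
      (r <= 'C(n + delta - 1, n - 1))%N,
      artinian_ideal (ideal_gen F)
    & fails_WLP_in_degree (ideal_gen F) (delta - 1)].

(* The set of lines of [k^m], that is, the projective space of dimension
   [m - 1] with [m] homogeneous coordinates. *)
Definition proj_space (k : fieldType) (m : nat) : Type :=
  {l : {vspace 'rV[k]_m} | \dim l == 1%N}.

Definition eval_forms (k : fieldType) (m r : nat)
    (F : r.-tuple {mpoly k[m]}) (v : 'rV[k]_m) : 'rV[k]_r :=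
  \row_i (tnth F i).@[fun j => v 0 j].

(* Near each point, [f] is given by forms of the same degree without common
   zero. The neighbourhood is the whole non-vanishing locus of [G]: to get any
   smaller neighbourhood, multiply all the entries of [G] by a form. *)
Definition regular_map (k : fieldType) (m r : nat)
    (f : proj_space k m -> proj_space k r) : Prop :=
  forall p : proj_space k m, exists (s : nat) (G : r.-tuple {mpoly k[m]}),
    [/\ (forall i, tnth G i \is s.-homog),
        (forall v : 'rV[k]_m, v \in val p -> v != 0 -> eval_forms G v != 0)
      & (forall (q : proj_space k m) (v : 'rV[k]_m),
           v \in val q -> v != 0 -> eval_forms G v != 0 ->
           val (f q) = <[eval_forms G v]>%VS)].

(* [phi = (F_1 : ... : F_r)]; as [val (phi p)] has dimension 1, this includes
   that the [F_i] have no common zero. *)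
Definition morphism_of_forms (k : fieldType) (m r : nat)
    (F : r.-tuple {mpoly k[m]}) (phi : proj_space k m -> proj_space k r) : Prop :=
  forall (p : proj_space k m) (v : 'rV[k]_m),
    v \in val p -> v != 0 -> val (phi p) = <[eval_forms F v]>%VS.

(* The elements of degree 0 of the localization [P_f], where [f] is a form of
   degree [delta]: the coordinate ring of the affine open set [f <> 0]. *)
Definition deg0_localization (k : fieldType) (m delta : nat)
    (f : {mpoly k[m]}) : {fraction {mpoly k[m]}} -> Prop :=
  fun z => exists (t : nat) (g : {mpoly k[m]}),
    g \is (t * delta).-homog /\ z = tofrac g / tofrac f ^+ t.

(* The comorphism of [(F_1 : ... : F_r)] over the chart [y_i <> 0], which sends
   the affine coordinate [y_j / y_i] to [F_j / F_i] ([y_i / y_i] goes to 1). *)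
Definition chart_comorphism (k : fieldType) (m r : nat)
    (F : r.-tuple {mpoly k[m]}) (i : 'I_r) (a : {mpoly k[r]}) :
    {fraction {mpoly k[m]}} :=
  mmap (fun c => tofrac c%:MP_[m])
       (fun j => tofrac (tnth F j) / tofrac (tnth F i)) a.

(* The morphism given by the forms [F], of degree [delta], is finite: the inverse
   image of each standard affine chart [y_i <> 0] is the affine open set
   [F_i <> 0], and its coordinate ring has to be a finite module over the
   coordinate ring of the chart. The latter maps onto the coordinate ring of the
   chart of the image, so finiteness onto the image is the same condition. *)
Definition finite_morphism (k : fieldType) (m delta r : nat)
    (F : r.-tuple {mpoly k[m]}) : Prop :=
  forall i : 'I_r, tnth F i != 0 ->
    exists (s : nat) (h : 'I_s -> {fraction {mpoly k[m]}}),
      (forall j, deg0_localization delta (tnth F i) (h j)) /\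
      (forall z, deg0_localization delta (tnth F i) z ->
         exists a : 'I_s -> {mpoly k[r]},
           z = \sum_j chart_comorphism F i (a j) * h j).

Definition proj_automorphism (k : fieldType) (m : nat)
    (sigma : proj_space k m -> proj_space k m) : Prop :=
  regular_map sigma /\
  exists2 tau, regular_map tau & cancel sigma tau /\ cancel tau sigma.

(* Membership in the group Aut(phi), whose law is composition. *)
Definition deck_automorphism (k : fieldType) (m r : nat)
    (phi : proj_space k m -> proj_space k r)
    (sigma : proj_space k m -> proj_space k m) : Prop :=
  proj_automorphism sigma /\ phi \o sigma =1 phi.

Definition deck_group_isog (k : fieldType) (m r : nat)
    (phi : proj_space k m -> proj_space k r)
    (gT : finGroupType) (G : {group gT}) : Prop :=
  exists psi : gT -> proj_space k m -> proj_space k m,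
    [/\ {in G, forall g, deck_automorphism phi (psi g)},
        {in G &, forall g h, psi (g * h)%g =1 psi g \o psi h},
        {in G &, forall g h, psi g =1 psi h -> g = h}
      & (forall sigma, deck_automorphism phi sigma ->
           exists2 g, g \in G & sigma =1 psi g)].

Definition deck_transitive_on_fibres (k : fieldType) (m r : nat)
    (phi : proj_space k m -> proj_space k r) : Prop :=
  forall p q, phi p = phi q ->
    exists2 sigma, deck_automorphism phi sigma & sigma p = q.

Definition GT_system (k : fieldType) (n delta r : nat)
    (F : r.-tuple {mpoly k[n.+1]}) (gT : finGroupType) (G : {group gT}) : Prop :=
  Togliatti_system delta F /\
  exists phi : proj_space k n.+1 -> proj_space k r,
    [/\ morphism_of_forms F phi,
        finite_morphism delta F,
        deck_transitive_on_fibres phi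
      & deck_group_isog phi G].

Definition rho_tau (k : fieldType) (d a : nat) (e : k) : 'M[k]_3 :=
  diag_mx (\row_(i < 3) [:: 1; e ^+ a; e ^+ (d - a)]`_i).

Definition mx_act (k : fieldType) (n : nat) (A : 'M[k]_n) (p : {mpoly k[n]}) :
    {mpoly k[n]} :=
  p \mPo [tuple \sum_(j < n) A j i *: 'X_j | i < n].

(* Invariance under all the elements of Gamma, which are the powers of
   [rho_tau] with exponent less than [d] since [e ^+ d = 1]. *)
Definition Gamma_invariant (k : fieldType) (d a : nat) (e : k)
    (p : {mpoly k[3]}) : bool :=
  [forall i : 'I_d, mx_act (rho_tau d a e ^+ i) p == p].

Definition xmon (k : fieldType) (c0 c1 c2 : nat) : {mpoly k[3]} :=
  'X_0 ^+ c0 * 'X_1 ^+ c1 * 'X_2 ^+ c2.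

(* The exponents of a monomial of degree [2d] are at most [2d]; [undup] identifies
   the two occurrences of each binomial, from [(c0, c1, c2)] and [(c0, c2, c1)]. *)
Definition B2d (k : fieldType) (d a : nat) (e : k) : seq {mpoly k[3]} :=
  let E := 'I_(2 * d).+1 in
  undup
   ([seq xmon k (2 * d - 2 * i) i i | i <- iota 0 d.+1] ++
    [seq xmon k c.1.1 c.1.2 c.2 + xmon k c.1.1 c.2 c.1.2
      | c : E * E * E <- enum {: E * E * E} &
        [&& (c.1.1 + c.1.2 + c.2 == 2 * d)%N, c.1.2 != c.2
          & Gamma_invariant d a e (xmon k c.1.1 c.1.2 c.2)]]).

(* Main.v *)
Require Import Defs.
From HB Require Import structures.
From mathcomp Require Import all_boot all_order all_algebra.
From mathcomp Require Import all_fingroup all_solvable.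
From mathcomp Require Import mpoly.
From mathcomp Require Import zify ring.
From Stdlib Require Import Classical.

Set Implicit Arguments.
Unset Strict Implicit.
Unset Printing Implicit Defensive.

Import GRing.Theory.

Local Open Scope ring_scope.

(** The generators are [x_0 ^ (2d - 2i) (x_1 x_2) ^ i], the binomials
    [x_0 ^ (d - 2j) (x_1 ^ (d + j) x_2 ^ j + x_1 ^ j x_2 ^ (d + j))] and
    [x_1 ^ (2d) + x_2 ^ (2d)], so there are [d + 3 + d / 2 <= 2d + 1] of them
    ([size_B2d]).  Everything else rests on four observations.

    They generate an ideal [I] that contains all monomials of large degree
    ([B2d_large_monomials]).  Hence the quotient is finite dimensional, thus
    artinian ([artinian_of_monomials]); the generators have no common zero
    ([no_common_zero_of_monomials]); and the morphism is finite, because a form of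
    large degree is a combination of the generators, which lowers the degree of
    the denominator ([finite_morphism_of_monomials]).

    Every dihedral invariant form of degree [2d] lies in [I]
    ([invariant_mem_ideal]), in particular the product of the [2d] conjugates of a
    linear form [L <> 0].  It is [L * f] with [f] of degree [2d - 1], a degree in
    which [I] vanishes, so multiplication by [L] is not injective
    ([relation_linear_form]).  Since the number of generators does not exceed
    [2d + 1 = dim R_(2d) - dim R_(2d-1)], it is not surjective either
    ([fails_WLP_of_relations]).

    The generators separate the dihedral orbits of the projective plane
    ([B2d_separates]), so the group is transitive on the fibres ([fibre_orbit]).
    For [x_0 <> 0] this is the statement that [x_1 x_2] and
    [x_1 ^ d + x_2 ^ d] separate the orbits of the dihedral group on the affine
    plane.  On the line [x_0 = 0] some care with the parity of [d] is needed
    ([line_orbit]).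

    Finally, a deck transformation agrees at each point with one of the [2d]
    dihedral maps; as the plane is irreducible, it agrees with the same one
    everywhere ([regular_map_finite_choice], [deck_is_dih_map]).  So the deck group
    is the dihedral group, which acts faithfully ([dih_map_inj]). *)

(** * Descending chains and artinian ideals *)

(** A subspace of maximal dimension among those contained in [W] is all of [W]. *)
Lemma subspace_repr (k : fieldType) (vT : vectType k) (W : vT -> Prop) :
  W 0 -> (forall a u v, W u -> W v -> W (a *: u + v)) ->
  exists U : {vspace vT}, forall v, W v <-> v \in U.
Proof.
move=> W0 Wlin.
have subW (U : {vspace vT}) v : (forall u, u \in U -> W u) -> W v ->
    forall u, u \in (<[v]> + U)%VS -> W u.
  by move=> UW Wv _ /memv_addP[_ /vlineP[a ->] [u Uu ->]]; exact/Wlin/UW.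
suff ext n : forall U : {vspace vT}, (dim vT - \dim U <= n)%N ->
    (forall u, u \in U -> W u) -> exists V : {vspace vT}, forall v, W v <-> v \in V.
  by apply: (ext _ 0%VS (leqnn _)) => u; rewrite memv0 => /eqP->.
elim: n => [|n IHn] U codimU UW.
  exists U => v; split=> [_|]; last exact: UW.
  suff -> : U = fullv by rewrite memvf.
  by apply/eqP; rewrite eqEdim subvf dimvf -subn_eq0 -leqn0.
case: (classic (exists2 v, W v & v \notin U)) => [[v Wv vU]|noext].
  apply: (IHn (<[v]> + U)%VS); last exact: subW.
  suff: (\dim U < \dim (<[v]> + U))%N by move: codimU; rewrite -dimvf; lia.
  rewrite (ltn_leqif (dimv_leqif_sup (addvSr _ _))) subv_add subvv andbT.
  by rewrite -memvE.
exists U => v; split=> [Wv|]; last exact: UW.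
by apply/negPn/negP => vU; apply: noext; exists v.
Qed.

Lemma subspace_chain_stationary (k : fieldType) (vT : vectType k)
    (W : nat -> vT -> Prop) :
  (forall m, W m 0) ->
  (forall m a u v, W m u -> W m v -> W m (a *: u + v)) ->
  (forall m v, W m.+1 v -> W m v) ->
  exists N, forall m, (N <= m)%N -> forall v, W N v -> W m v.
Proof.
move=> W0 Wlin Wdec.
have repr m := subspace_repr (W0 m) (Wlin m).
have dec m n v : (m <= n)%N -> W n v -> W m v.
  by move/subnKC<-; elim: (n - m)%N v => [|i IHi] v;
    rewrite ?addn0 // addnS => /Wdec/IHi.
(* A member of the chain whose dimension is minimal. *)
suff [N [U UN minU]] : exists N, exists2 U : {vspace vT},
    (forall v, W N v <-> v \in U) &
    forall m (V : {vspace vT}), (forall v, W m v <-> v \in V) ->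
      (\dim U <= \dim V)%N.
  exists N => m leNm v; have [V Vm] := repr m.
  rewrite Vm UN; suff -> : V = U by [].
  apply/eqP; rewrite eqEdim (minU m V) // andbT.
  by apply/subvP => u /Vm /(dec _ _ _ leNm) /UN.
suff min n N (U : {vspace vT}) : (forall v, W N v <-> v \in U) -> (\dim U <= n)%N ->
    exists N, exists2 U : {vspace vT}, (forall v, W N v <-> v \in U) &
    forall m (V : {vspace vT}), (forall v, W m v <-> v \in V) ->
      (\dim U <= \dim V)%N.
  by have [U0 U0E] := repr 0%N; apply: (min _ _ _ U0E (leqnn _)).
elim: n N U => [|n IHn] N U UN dimU.
  by exists N, U => // m V _; apply: leq_trans dimU _.
case: (classic (exists m, exists2 V : {vspace vT},
    (forall v, W m v <-> v \in V) & (\dim V < \dim U)%N)).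
  by case=> m [V Vm ltVU]; apply: (IHn m V Vm); rewrite -ltnS (leq_trans ltVU).
move=> nomin; exists N, U => // m V Vm; rewrite leqNgt; apply/negP => ltVU.
by apply: nomin; exists m, V.
Qed.

Lemma ideal_sum (P : comNzRingType) (J : P -> Prop) (I : Type) (s : seq I)
    (Q : pred I) (E : I -> P) :
  is_ideal J -> (forall i, Q i -> J (E i)) -> J (\sum_(i <- s | Q i) E i).
Proof. by case=> J0 JD _ JE; apply: big_ind. Qed.

Lemma ideal_gen_ideal (P : comNzRingType) r (F : r.-tuple P) :
  is_ideal (ideal_gen F).
Proof.
split=> [|_ _ [b ->] [c ->]|c _ [b ->]].
- by exists (fun=> 0); rewrite big1 // => i _; rewrite mul0r.
- by exists (fun i => b i + c i); rewrite -big_split; apply: eq_bigr => i _;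
    rewrite mulrDl.
- by exists (fun i => c * b i); rewrite mulr_sumr; apply: eq_bigr => i _;
    rewrite mulrA.
Qed.

Lemma mem_ideal_gen (P : comNzRingType) r (F : r.-tuple P) p :
  p \in F -> ideal_gen F p.
Proof.
case/tnthP => i ->; exists (fun j => (j == i)%:R).
by rewrite (bigD1 i) //= eqxx mul1r big1 ?addr0 // => j /negPf->; rewrite mul0r.
Qed.

(** The quotient by [I] is spanned by the finitely many monomials of degree less
    than [N], so a chain of ideals above [I] is determined by its traces on the
    finite dimensional space of these polynomials. *)
Lemma artinian_of_monomials (k : fieldType) n (I : {mpoly k[n]} -> Prop) N :
  (forall m : 'X_{1..n}, (N <= mdeg m)%N -> I 'X_[m]) -> artinian_ideal I.
Proof.
move=> Imon J idJ IJ Jdec.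
have JZ m c p : J m p -> J m (c *: p).
  by case: (idJ m) => _ _ JM Jp; rewrite -mul_mpolyC; apply: JM.
pose low (f : {ffun 'X_{1..n < N} -> k^o}) : {mpoly k[n]} :=
  \sum_(m : 'X_{1..n < N}) f m *: 'X_[m].
have lowP a f g : low (a *: f + g) = a *: low f + low g.
  rewrite /low scaler_sumr -big_split; apply: eq_bigr => m _ /=.
  by rewrite !ffunE scalerDl scalerA.
have low0 : low 0 = 0 by rewrite /low big1 // => m _; rewrite ffunE scale0r.
have [M stat] : exists M, forall m, (M <= m)%N ->
    forall f, J M (low f) -> J m (low f).
  apply: (subspace_chain_stationary (W := fun m f => J m (low f))) => [m|m a u v|].
  - by rewrite low0; case: (idJ m).
  - by rewrite lowP => Ju Jv; have [_ JD _] := idJ m; apply: JD => //; apply: JZ.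
  - by move=> m f; apply: Jdec.
exists M => m leMm p Jp.
pose f : {ffun 'X_{1..n < N} -> k^o} := [ffun m : 'X_{1..n < N} => p@_m].
have Jhigh i : J i (p - low f).
  rewrite [X in J i X]mpolyE big_seq; apply: (ideal_sum _ (idJ i)) => q.
  rewrite mcoeff_msupp => pq; apply/JZ/IJ/Imon; rewrite leqNgt.
  apply: contraNN pq => ltq; rewrite mcoeffB /low.
  under eq_bigr do rewrite ffunE.
  by rewrite (mcoeff_mpoly (fun m => p@_m) ltq) subrr.
have [_ JD _] := idJ m; rewrite -(subrK (low f) p); apply: JD => //.
apply: stat => //; have [_ JD' _] := idJ M.
by rewrite -(subKr p (low f)) addrC; apply: JD' => //; rewrite -scaleN1r; apply: JZ.
Qed.

(** * Forms in an ideal generated in one degree *)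

Section Homogeneous.
Variables (k : fieldType) (n : nat).
Implicit Types (p q c : {mpoly k[n]}).

Lemma pihomogM d e c p : p \is d.-homog ->
  pihomog mdeg (e + d) (c * p) = pihomog mdeg e c * p.
Proof.
move=> hp; pose K := maxn (msize c) e.+1.
rewrite {1}(pihomog_partitionE (leq_maxl (msize c) e.+1) : c = _) mulr_suml raddf_sum /=.
have ltK : (e < K)%N by rewrite leq_max leqnn orbT.
rewrite (bigD1 (Ordinal ltK)) //= big1 ?addr0 => [|i ne_ie].
  by rewrite pihomog_dE //; apply: dhomogM => //; apply: pihomogP.
apply: (pihomog_ne0 (d := (i + d)%N)); last by apply: dhomogM => //; apply: pihomogP.
by rewrite eqn_add2r; apply: contraNN ne_ie => /eqP ie; apply/eqP/val_inj.
Qed.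

Lemma pihomogM_lt d e c p : p \is d.-homog -> (e < d)%N ->
  pihomog mdeg e (c * p) = 0.
Proof.
move=> hp lt_ed.
rewrite (pihomog_partitionE (leqnn (msize c)) : c = _) mulr_suml raddf_sum /=.
rewrite big1 // => i _; apply: (pihomog_ne0 (d := (i + d)%N)).
  by rewrite neq_ltn (leq_trans lt_ed) ?leq_addl ?orbT.
by apply: dhomogM => //; apply: pihomogP.
Qed.

Lemma dhomog0_const p : p \is 0.-homog -> p = (p@_0%MM)%:MP.
Proof.
move=> hp; apply/mpolyP => m; rewrite mcoeffC; case: eqP => [->|/eqP m0].
  by rewrite mulr1.
by rewrite mulr0 (dhomog_nemf_coeff hp) // mdeg_eq0.
Qed.

Lemma dhomog_prod_ord d N (E : 'I_N -> {mpoly k[n]}) :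
  (forall i, E i \is d.-homog) -> \prod_i E i \is (N * d).-homog.
Proof.
elim: N E => [|N IHN] E hE; first by rewrite big_ord0 dhomog1.
rewrite big_ord_recl mulSn; apply: dhomogM => //.
by apply: IHN => i.
Qed.

Variables (delta r : nat) (F : r.-tuple {mpoly k[n]}).
Hypothesis homF : forall i, tnth F i \is delta.-homog.

Lemma ideal_gen_low_degree j p :
  (j < delta)%N -> p \is j.-homog -> ideal_gen F p -> p = 0.
Proof.
move=> ltj hp [c pE]; rewrite -(pihomog_dE hp) pE raddf_sum /= big1 // => i _.
exact: pihomogM_lt.
Qed.

(** In the degree of the generators only the constant terms of the coefficients
    contribute. *)
Lemma ideal_gen_gen_degree p :
  p \is delta.-homog -> ideal_gen F p ->
  exists c : 'I_r -> k, p = \sum_i c i *: tnth F i.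
Proof.
move=> hp [c pE]; exists (fun i => (pihomog mdeg 0 (c i))@_0%MM).
rewrite -(pihomog_dE hp) pE raddf_sum /=; apply: eq_bigr => i _.
rewrite -[in LHS](add0n delta) pihomogM //.
by rewrite {1}(dhomog0_const (pihomogP _ _ _)) mul_mpolyC.
Qed.

End Homogeneous.

(** Write [R] for the polynomial ring, [I] for the ideal and [delta = j + 1].
    Below degree [delta] the ideal vanishes, so a relation [L * f] in [I] with
    [f <> 0] of degree [j] refutes injectivity.  It also refutes surjectivity:
    [R_delta] would be the image of [k^r * R_j] under [(c, f) |-> sum c_i F_i + L f],
    which is not injective, whereas
    [r <= 'C(n + delta - 1, n - 1) = dim R_delta - dim R_j]. *)
Lemma fails_WLP_of_relations (k : fieldType) n delta r
    (F : r.-tuple {mpoly k[n.+1]}) :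
  (0 < n)%N -> (0 < delta)%N ->
  (forall i, tnth F i \is delta.-homog) ->
  (r <= 'C(n + delta - 1, n - 1))%N ->
  (forall L : {mpoly k[n.+1]}, L \is 1.-homog -> L != 0 ->
     exists f, [/\ f \is (delta - 1).-homog, f != 0 & ideal_gen F (L * f)]) ->
  fails_WLP_in_degree (ideal_gen F) (delta - 1).
Proof.
case: delta => // j n0 _ homF ler rel; rewrite subSS subn0 in rel *.
move=> L hL; have [f [hf f0 ILf]] :
    exists f, [/\ f \is j.-homog, f != 0 & ideal_gen F (L * f)].
  have [->|] := eqVneq L 0; last exact: rel.
  exists 'X_[U_(ord0) *+ j]; split; last first.
  - by rewrite mul0r; case: (ideal_gen_ideal F).
  - by rewrite -msize_poly_eq0 msizeX.
  - by rewrite dhomogX /= mdegMn mdeg1 mul1n.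
split=> [inj|surj].
  by case/eqP: f0; apply: (ideal_gen_low_degree homF (ltnSn j) hf); apply: inj.
pose phi0 (u : 'rV[k]_r * dhomog n.+1 k j) : {mpoly k[n.+1]} :=
  \sum_i u.1 0 i *: tnth F i + L * val u.2.
have homphi u : phi0 u \is j.+1.-homog.
  apply: rpredD; first by apply: rpred_sum => i _; apply: rpredZ.
  exact: (dhomogM hL (valP u.2)).
pose phi u := DHomog (homphi u).
have phiP : linear phi.
  move=> a u v; apply: val_inj; rewrite /= /phi0 /= mulrDr -scalerAr scalerDr.
  rewrite scaler_sumr addrACA -big_split; congr (_ + _); apply: eq_bigr => i _ /=.
  by rewrite !mxE scalerDl scalerA.
pose phiL : {linear _ -> _} := HB.pack phi (GRing.isLinear.Build _ _ _ _ _ phiP).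
pose Phi := linfun phiL.
have PhiE u : Phi u = phi u by rewrite lfunE.
have kerPhi : lker Phi != 0%VS.
  have hLf : L * f \is j.+1.-homog by exact: (dhomogM hL hf).
  have [c Lf] := ideal_gen_gen_degree homF hLf ILf.
  apply: contraNneq f0 => ker0.
  have: ((- \row_i c i, DHomog hf) : 'rV[k]_r * dhomog n.+1 k j) \in lker Phi.
    rewrite memv_ker PhiE; apply/eqP/val_inj; rewrite /= /phi0 /= Lf -big_split.
    by apply: big1 => i _ /=; rewrite !mxE scaleNr addNr.
  by rewrite ker0 memv0 => /eqP[_ ->].
have surjPhi : limg Phi = fullv.
  apply/eqP; rewrite eqEsubv subvf; apply/subvP => g _.
  have [h hh [c gE]] := surj (val g) (valP g).
  have hgLh : val g - L * h \is j.+1.-homog.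
    by apply: rpredB; [exact: (valP g)|exact: (dhomogM hL hh)].
  have [b gb] := ideal_gen_gen_degree homF hgLh (ex_intro _ c gE).
  have -> : g = Phi (\row_i b i, DHomog hh); last exact: memv_img (memvf _).
  apply: val_inj; rewrite PhiE /= /phi0 /=.
  by under eq_bigr do rewrite mxE; rewrite -gb subrK.
have := limg_ker_dim Phi fullv.
rewrite capfv -/(limg Phi) surjPhi !dimvf.
have -> : dim ('rV[k]_r * dhomog n.+1 k j)%type = (1 * r + 'C(j + n, j))%N by [].
have -> : dim (dhomog n.+1 k j.+1) = 'C(j.+1 + n, j.+1) by [].
have : 'C(n + j.+1 - 1, n - 1) = 'C(j + n, j.+1).
  rewrite addnS subn1 /= addnC -bin_sub; last by lia.
  by congr ('C(_, _)); lia.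
rewrite addSn binS; have := dimv_eq0 (lker Phi); rewrite (negPf kerPhi); lia.
Qed.

(** * Points and regular maps of projective spaces *)

Section Vanishing.
Variable k : closedFieldType.

(** An algebraically closed field is infinite, so one variable at a time can be
    specialised to a value at which some coefficient survives. *)
Lemma mpoly_nonroot n (p : {mpoly k[n]}) :
  p != 0 -> exists v : 'rV[k]_n, p.@[fun i => v 0 i] != 0.
Proof.
elim: n p => [|n IHn] p p0.
  by exists 0; move: p0; rewrite (nvar0_mpolyC p) mevalC mpolyC_eq0.
pose rest (m : 'X_{1..n.+1}) := [multinom m (widen_ord (leqnSn n) i) | i < n].
have restI (m1 m2 : 'X_{1..n.+1}) : rest m1 = rest m2 -> m1 ord_max = m2 ord_max -> m1 = m2.
  move=> /mnmP eq_rest eq_max; apply/mnmP => i.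
  have [lt_in|] := ltnP i n; last first.
    move=> le_ni; have -> : i = ord_max; last by [].
    by apply/val_inj/anti_leq; rewrite le_ni -ltnS ltn_ord.
  have := eq_rest (Ordinal lt_in); rewrite !mnmE.
  by have -> : widen_ord (leqnSn n) (Ordinal lt_in) = i by apply: val_inj.
pose m0 := mlead p.
have pm0 : p@_m0 != 0 by rewrite mleadc_eq0.
have uni0 : (muni p)`_(m0 ord_max) != 0.
  suff pE : p@_m0 = ((muni p)`_(m0 ord_max))@_(rest m0).
    by apply: contraNneq pm0 => m0E; rewrite pE m0E mcoeff0.
  rewrite muniE coef_sum raddf_sum /=.
  rewrite (bigD1_seq m0) ?msupp_uniq ?mcoeff_msupp //= -/(rest _).
  rewrite coefZ coefXn eqxx mulr1 mcoeffZ mcoeffX eqxx mulr1 big1 ?addr0 // => m ne_m.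
  rewrite coefZ coefXn -/(rest m); case: eqP => [eq_max|]; last by rewrite mulr0 mcoeff0.
  rewrite mulr1 mcoeffZ mcoeffX; case: eqP => [eq_rest|]; last by rewrite mulr0.
  by rewrite (restI m m0) ?eqxx in ne_m.
have [w w0] := IHn _ uni0.
pose q := map_poly (meval (fun i => w 0 i)) (muni p).
have /closed_nonrootP[t qt] : q != 0.
  by apply: contraNneq w0 => /(congr1 (fun s : {poly k} => s`_(m0 ord_max)));
    rewrite coef_map coef0 /= => ->.
exists (\row_(i < n.+1) if unlift ord_max i is Some j then w 0 j else t).
suff -> : p.@[fun i => (\row_(i < n.+1) if unlift ord_max i is Some j then w 0 j else t) 0 i] = q.[t].
  by [].
rewrite /q muniE rmorph_sum horner_sum mevalE; apply: eq_bigr => m _ /=.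
rewrite map_polyZ map_polyXn hornerZ hornerXn /= mevalZ mevalX big_ord_recr /= -mulrA.
rewrite !mxE unlift_none; congr (_ * (_ * _)).
apply: eq_bigr => i _; rewrite mxE mnmE.
have -> : widen_ord (leqnSn n) i = lift ord_max i.
  by apply: val_inj; rewrite /= /bump leqNgt ltn_ord.
by rewrite liftK.
Qed.

Lemma meval_homog n d (p : {mpoly k[n]}) (c : k) (v : 'I_n -> k) :
  p \is d.-homog -> p.@[fun i => c * v i] = c ^+ d * p.@[v].
Proof.
move=> hp; rewrite !mevalE mulr_sumr !big_seq; apply: eq_bigr => m mp.
rewrite mulrCA -(dhomog_mf hp mp) /= mdegE expr_sum -big_split; congr (_ * _).
by apply: eq_bigr => i _; rewrite exprMn.
Qed.

End Vanishing.

Section Projective.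
Variable k : closedFieldType.

Lemma vline_scale m (c : k) (v : 'rV[k]_m) : c != 0 -> <[c *: v]>%VS = <[v]>%VS.
Proof.
move=> c0; apply/eqP; rewrite eqEdim -memvE memvZ ?memv_line // !dim_vline.
by rewrite scaler_eq0 (negPf c0) leqnn.
Qed.

Lemma vline_eqP m (u w : 'rV[k]_m) : u != 0 -> w != 0 ->
  reflect (exists2 c, c != 0 & w = c *: u) (<[u]>%VS == <[w]>%VS).
Proof.
move=> u0 w0; apply: (iffP eqP) => [uw|[c c0 ->]]; last by rewrite vline_scale.
have /vlineP[c wE] : w \in <[u]>%VS by rewrite uw memv_line.
by exists c => //; apply: contraNneq w0 => c0; rewrite wE c0 scale0r.
Qed.

Lemma vline_minorsP m (u w : 'rV[k]_m) : u != 0 -> w != 0 ->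
  <[u]>%VS = <[w]>%VS <-> (forall i j, u 0 i * w 0 j = u 0 j * w 0 i).
Proof.
move=> u0 w0; split=> [/eqP/(vline_eqP u0 w0)[c _ ->] i j|uw].
  by rewrite !mxE; ring.
have /rV0Pn[i ui] := u0; apply/eqP/(vline_eqP u0 w0).
have wE : w = (w 0 i / u 0 i) *: u.
  apply/rowP => j; rewrite mxE; apply: (mulfI ui); rewrite uw.
  by field.
exists (w 0 i / u 0 i) => //.
by apply: contraNneq w0 => c0; rewrite wE c0 scale0r.
Qed.

Lemma proj_nonzero m (p : proj_space k m) : vpick (val p) != 0.
Proof. by rewrite vpick0 -dimv_eq0 (eqP (valP p)). Qed.

Lemma proj_line m (p : proj_space k m) v :
  v \in val p -> v != 0 -> val p = <[v]>%VS.
Proof.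
move=> vp v0; apply/eqP; rewrite eq_sym eqEdim -memvE vp dim_vline v0.
by rewrite (eqP (valP p)).
Qed.

Lemma line_dim1 m (v : 'rV[k]_m) : v != 0 -> \dim <[v]> == 1%N.
Proof. by rewrite dim_vline => ->. Qed.

Definition proj_point m (v : 'rV[k]_m) (v0 : v != 0) : proj_space k m :=
  Sub <[v]>%VS (line_dim1 v0).

Lemma mem_proj_point m (v : 'rV[k]_m) (v0 : v != 0) : v \in val (proj_point v0).
Proof. exact: memv_line. Qed.

Lemma eval_formsE m r (F : r.-tuple {mpoly k[m]}) v i :
  eval_forms F v 0 i = (tnth F i).@[fun j => v 0 j].
Proof. by rewrite mxE. Qed.

Lemma eval_forms_scale m r s (F : r.-tuple {mpoly k[m]}) c v :
  (forall i, tnth F i \is s.-homog) -> eval_forms F (c *: v) = c ^+ s *: eval_forms F v.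
Proof.
move=> hF; apply/rowP => i; rewrite !mxE -(meval_homog _ _ (hF i)).
by apply: meval_eq => j; rewrite mxE.
Qed.

Section MapOfForms.
Variables (m r s : nat) (F : r.-tuple {mpoly k[m]}).
Hypothesis homF : forall i, tnth F i \is s.-homog.
Hypothesis F_neq0 : forall v, v != 0 -> eval_forms F v != 0.

Definition map_of_forms (p : proj_space k m) : proj_space k r :=
  proj_point (F_neq0 (proj_nonzero p)).

Lemma map_of_formsP : morphism_of_forms F map_of_forms.
Proof.
move=> p v vp v0; rewrite /= /map_of_forms /=.
have /vlineP[c vE] : v \in <[vpick (val p)]>%VS.
  by rewrite -(proj_line (memv_pick _) (proj_nonzero p)).
rewrite vE (eval_forms_scale _ _ homF) vline_scale //; apply: expf_neq0.
by apply: contraNneq v0 => c0; rewrite vE c0 scale0r.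
Qed.

End MapOfForms.

Lemma morphism_of_forms_neq0 m r (F : r.-tuple {mpoly k[m]}) phi v :
  morphism_of_forms F phi -> v != 0 -> eval_forms F v != 0.
Proof.
move=> phiF v0; have := phiF (proj_point v0) v (mem_proj_point v0) v0.
case: (phi _) => l /= l1 lE; apply: contraTneq l1 => F0.
by rewrite lE F0 dim_vline eqxx.
Qed.

Lemma regular_morphism_of_forms m r s (F : r.-tuple {mpoly k[m]}) phi :
  (forall i, tnth F i \is s.-homog) -> morphism_of_forms F phi -> regular_map phi.
Proof.
move=> homF phiF p; exists s, F; split=> // [v _ v0|q v vq v0 _].
  exact: morphism_of_forms_neq0 phiF v0.
exact: phiF.
Qed.

(** The points at which [f] and [h t] coincide form a closed set, cut out by the
    2x2 minors of their coordinates.  Projective space is irreducible, so if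
    finitely many of these sets cover it then one of them is everything. *)
Lemma regular_map_finite_choice n r (T : finType)
    (f : proj_space k n.+1 -> proj_space k r)
    (H : T -> r.-tuple {mpoly k[n.+1]}) (h : T -> proj_space k n.+1 -> proj_space k r) :
  regular_map f -> (forall t, morphism_of_forms (H t) (h t)) ->
  (forall p, exists t, f p = h t p) -> exists t, f =1 h t.
Proof.
move=> regf hH cover.
pose minor t (G : r.-tuple {mpoly k[n.+1]}) i j :=
  tnth G i * tnth (H t) j - tnth G j * tnth (H t) i.
have minorE t G i j (v : 'rV[k]_n.+1) : (minor t G i j).@[fun l => v 0 l] =
    eval_forms G v 0 i * eval_forms (H t) v 0 j -
    eval_forms G v 0 j * eval_forms (H t) v 0 i.
  by rewrite /minor rmorphB !rmorphM !eval_formsE.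
have Hneq0 t v : v != 0 -> eval_forms (H t) v != 0.
  exact: (morphism_of_forms_neq0 (hH t)).
(* The factor [X_0] makes sure that the nonroot is not the origin. *)
have nonroot (Q : {mpoly k[n.+1]}) : Q != 0 ->
    exists2 v : 'rV[k]_n.+1, v != 0 & Q.@[fun l => v 0 l] != 0.
  move=> Q0; have : Q * 'X_ord0 != 0.
    by rewrite mulf_neq0 // -msize_poly_eq0 msizeX.
  move=> /mpoly_nonroot[v]; rewrite rmorphM /= mevalXU mulf_eq0 negb_or.
  case/andP => Qv v0; exists v => //; apply: contraNneq v0 => ->.
  by rewrite mxE.
have e0 : (\row_(i < n.+1) 1 : 'rV[k]_n.+1) != 0.
  by apply/rV0Pn; exists ord0; rewrite mxE oner_eq0.
have [s [G [_ Gnz Gf]]] := regf (proj_point e0).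
have /rV0Pn[i0 Gi0] := Gnz _ (mem_proj_point e0) e0.
have G0 : tnth G i0 != 0.
  by apply: contraNneq Gi0; rewrite eval_formsE => ->; rewrite meval0.
have Gvneq0 (v : 'rV[k]_n.+1) : (tnth G i0).@[fun l => v 0 l] != 0 -> eval_forms G v != 0.
  by move=> Gv; apply/rV0Pn; exists i0; rewrite eval_formsE.
have [t /forallP tP] : exists t, [forall i, forall j, minor t G i j == 0].
  have [/existsP//|/existsPn nomin] :=
    boolP [exists t, [forall i, forall j, minor t G i j == 0]].
  have ij t : {ij : 'I_r * 'I_r | minor t G ij.1 ij.2 != 0}.
    apply: sigW; have /forallPn[i /forallPn[j Mij]] := nomin t.
    by exists (i, j).
  pose Q := tnth G i0 * \prod_t minor t G (sval (ij t)).1 (sval (ij t)).2.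
  have /nonroot[v v0] : Q != 0.
    by rewrite mulf_neq0 //; apply/prodf_neq0 => t _; case: (ij t).
  rewrite rmorphM rmorph_prod mulf_eq0 negb_or => /andP[Gv /prodf_neq0 Mv].
  have [t ft] := cover (proj_point v0).
  have Gv0 := Gvneq0 _ Gv.
  have eqGH := Gf _ v (mem_proj_point v0) v0 Gv0.
  rewrite ft (hH t _ v (mem_proj_point v0) v0) in eqGH.
  have /vline_minorsP/=/(_ (Gvneq0 _ Gv) (Hneq0 t _ v0)) mij := esym eqGH.
  by have := Mv t isT; rewrite /= minorE mij subrr eqxx.
have GH v : v != 0 -> eval_forms G v != 0 ->
    <[eval_forms G v]>%VS = <[eval_forms (H t) v]>%VS.
  move=> v0 Gv0; apply/vline_minorsP => //; first exact: Hneq0.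
  move=> i j; apply/eqP; rewrite -subr_eq0 -minorE.
  by have /forallP/(_ j)/eqP-> := tP i; rewrite meval0.
exists t => p; have [s' [G' [_ G'nz G'f]]] := regf p.
have minor0 i j : minor t G' i j = 0.
  apply/eqP/negPn/negP => Mij.
  have /nonroot[v v0] : tnth G i0 * minor t G' i j != 0 by rewrite mulf_neq0.
  rewrite rmorphM mulf_eq0 negb_or => /andP[Gv]; rewrite /= minorE => Mv.
  have G'v0 : eval_forms G' v != 0.
    by apply: contraNneq Mv => ->; rewrite !mxE !mul0r subrr.
  have Gv0 := Gvneq0 _ Gv.
  have eqG := Gf _ v (mem_proj_point v0) v0 Gv0.
  rewrite (G'f _ v (mem_proj_point v0) v0 G'v0) GH // in eqG.
  have /vline_minorsP/=/(_ G'v0 (Hneq0 t _ v0)) mij := eqG.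
  by rewrite mij subrr eqxx in Mv.
pose v := vpick (val p); have v0 : v != 0 := proj_nonzero p.
have vp : v \in val p := memv_pick _.
have G'v0 := G'nz v vp v0.
apply: val_inj; rewrite (G'f p v vp v0 G'v0) (hH t p v vp v0).
apply/vline_minorsP => //; first exact: Hneq0.
by move=> i j; apply/eqP; rewrite -subr_eq0 -minorE minor0 meval0.
Qed.

End Projective.

(** * Coordinates on the dihedral group *)

(** Every element of the dihedral group is uniquely [x ^+ i * y ^+ b] with
    [i < q] and [b] a boolean, for the rotation [x] and the reflection [y] of its
    presentation; the multiplication rule is the relation [y * x = x^-1 * y]. *)
Lemma dihedral_coordinates q : (1 < q)%N ->
  exists (rot : 'D_(2 * q) -> 'I_q) (refl : 'D_(2 * q) -> bool),
  [/\ forall g h, (rot (g * h)%g =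
        rot g + (if refl g then q - rot h else rot h) %[mod q])%N,
      forall g h, refl (g * h)%g = refl g (+) refl h,
      injective (fun g => (rot g, refl g))
    & forall i b, exists g, (rot g, refl g) = (i, b)].
Proof.
move=> q_gt1; rewrite mul2n.
have q_gt0 : (0 < q)%N := ltnW q_gt1.
have [_] := isoGrpP _ (Grp_dihedral q_gt1) (isog_refl 'D_q.*2).
case/existsP => -[x y] /= /eqP[defD xq y2 xy].
have {}defD : (<[x]> * <[y]>)%g = [set: 'D_q.*2].
  by rewrite -norm_joinEr // norms_cycle xy groupV cycle_id.
pose f (u : 'I_q * bool) : 'D_q.*2 := (x ^+ u.1 * y ^+ u.2)%g.
have fS g : exists u, f u = g.
  have : g \in (<[x]> * <[y]>)%g by rewrite defD inE.
  case/mulsgP => _ _ /cycleP[i ->] /cycleP[j ->] ->.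
  exists (Ordinal (ltn_pmod i q_gt0), odd j); rewrite /f /= expg_mod //.
  by rewrite -modn2 expg_mod.
have f_inj : injective f.
  have /imset_injP : #|f @: setT| == #|[set: 'I_q * bool]|; last first.
    by move=> fI u v; apply: fI; rewrite inE.
  suff -> : f @: setT = [set: 'D_q.*2].
    by rewrite card_dihedral // cardsT card_prod card_ord card_bool muln2.
  by apply/setP => g; rewrite inE; have [u <-] := fS g; rewrite imset_f ?inE.
have [c fK cK] : bijective f.
  apply: inj_card_bij f_inj _; rewrite -cardsT card_dihedral //.
  by rewrite card_prod card_ord card_bool muln2.
have yx (b : bool) (j : 'I_q) :
    (y ^+ b * x ^+ j = x ^+ (if b then (q - j)%N else j) * y ^+ b)%g.
  case: b; rewrite ?expg0 ?mul1g ?mulg1 // expg1 [RHS]conjgC conjXg xy.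
  congr (_ * _)%g; apply: (mulgI (x ^- j)%g); rewrite mulVg expgVn -invMg.
  by rewrite -expgD subnK ?xq ?invg1 // ltnW.
exists (fun g => (c g).1), (fun g => (c g).2).
have cM g h : c (g * h)%g =
    (Ordinal (ltn_pmod ((c g).1 + (if (c g).2 then q - (c h).1 else (c h).1))%N q_gt0),
     (c g).2 (+) (c h).2).
  apply: (canLR fK); rewrite -{1}(cK g) -{1}(cK h) /f /= expg_mod // expgD.
  rewrite -!mulgA; congr (_ * _)%g; rewrite !mulgA yx -!mulgA; congr (_ * _)%g.
  by case: (c g).2 (c h).2 => [] []; rewrite ?expg0 ?mulg1 ?mul1g // -expg1 -expgD.
split=> [g h|g h|g h|i b]; rewrite ?cM //=.
- by rewrite modn_mod.
- by rewrite -!surjective_pairing => /(can_inj cK).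
- by exists (f (i, b)); rewrite fK.
Qed.

(** * Ternary monomials and the generators *)

Section Ternary.
Variable k : fieldType.
Implicit Types (p : {mpoly k[3]}) (m : 'X_{1..3}).

Lemma ord3_ind (Q : 'I_3 -> Prop) : Q 0 -> Q 1 -> Q 2 -> forall i, Q i.
Proof.
move=> Q0 Q1 Q2 [[|[|[|//]]] lti].
- by rewrite (_ : Ordinal lti = 0) //; apply: val_inj.
- by rewrite (_ : Ordinal lti = 1) //; apply: val_inj.
- by rewrite (_ : Ordinal lti = 2) //; apply: val_inj.
Qed.

Lemma big_ord3 (T : Type) (idx : T) (op : Monoid.law idx) (E : 'I_3 -> T) :
  \big[op/idx]_i E i = op (op (E 0) (E 1)) (E 2).
Proof.
rewrite !big_ord_recl big_ord0 Monoid.mulm1 Monoid.mulmA.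
by congr (op (op _ (E _)) (E _)); apply: val_inj.
Qed.

Definition mnm3 c0 c1 c2 : 'X_{1..3} := [multinom nth 0%N [:: c0; c1; c2] i | i < 3].

Lemma mnm3_eta m : m = mnm3 (m 0) (m 1) (m 2).
Proof. by apply/mnmP; apply: ord3_ind; rewrite mnmE. Qed.

Lemma mdeg3 m : mdeg m = (m 0%R + m 1%R + m 2%R)%N.
Proof. by rewrite mdegE big_ord3. Qed.

Lemma xmonE c0 c1 c2 : xmon k c0 c1 c2 = 'X_[mnm3 c0 c1 c2].
Proof. by rewrite mpolyXE_id big_ord3 !mnmE. Qed.

Lemma mpolyX3E m : 'X_[m] = xmon k (m 0) (m 1) (m 2).
Proof. by rewrite xmonE -mnm3_eta. Qed.

Lemma xmonM a0 a1 a2 b0 b1 b2 :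
  xmon k a0 a1 a2 * xmon k b0 b1 b2 = xmon k (a0 + b0) (a1 + b1) (a2 + b2).
Proof. by rewrite /xmon !exprD; ring. Qed.

Lemma xmon_neq0 c0 c1 c2 : xmon k c0 c1 c2 != 0.
Proof. by rewrite xmonE -msize_poly_eq0 msizeX. Qed.

Lemma xmon_homog c0 c1 c2 : xmon k c0 c1 c2 \is (c0 + c1 + c2).-homog.
Proof. by rewrite xmonE dhomogX /= mdeg3 !mnmE. Qed.

Lemma meval_xmon c0 c1 c2 (v : 'I_3 -> k) :
  (xmon k c0 c1 c2).@[v] = v 0 ^+ c0 * v 1 ^+ c1 * v 2 ^+ c2.
Proof. by rewrite /xmon !rmorphM !rmorphXn /= !mevalXU. Qed.

Lemma mcoeff_comp_scale n (c : 'I_n -> k) (p : {mpoly k[n]}) (m : 'X_{1..n}) :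
  (p \mPo [tuple c i *: 'X_i | i < n])@_m = (\prod_i c i ^+ m i) * p@_m.
Proof.
rewrite comp_mpolyEX raddf_sum /=.
under eq_bigr => q _.
  rewrite comp_mpolyX mcoeffZ.
  under eq_bigr do rewrite tnth_mktuple exprZn.
  rewrite scaler_prod -mpolyXE_id mcoeffZ mcoeffX.
  over.
have [mp|/[dup] mp /memN_msupp_eq0->] := boolP (m \in msupp p).
  rewrite (bigD1_seq m) ?msupp_uniq //= eqxx mulr1 [RHS]mulrC [X in _ + X]big1 ?addr0 // => q.
  by move/negPf->; rewrite !mulr0.
rewrite mulr0 big_seq big1 // => q qp; case: eqP => [qm|]; last by rewrite !mulr0.
by rewrite -qm qp in mp.
Qed.

Definition swap12 : 'S_3 := tperm 1 2.

Lemma mperm_swap12 c0 c1 c2 :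
  [multinom (mnm3 c0 c1 c2) (swap12 i) | i < 3] = mnm3 c0 c2 c1.
Proof.
apply/mnmP; apply: ord3_ind; rewrite !mnmE ?tpermL ?tpermR //.
by rewrite tpermD.
Qed.

Lemma msym_xmon c0 c1 c2 : msym swap12 (xmon k c0 c1 c2) = xmon k c0 c2 c1.
Proof. by rewrite !xmonE msymX tpermV mperm_swap12. Qed.

End Ternary.

Section Generators.
Variables (k : fieldType) (d a : nat) (e : k).
Hypotheses (e_prim : d.-primitive_root e) (a_d : coprime a d) (d_gt1 : (1 < d)%N).
Hypothesis a_lt_d : (a < d)%N.

Lemma rho_tauX i : rho_tau d a e ^+ i =
  diag_mx (\row_(j < 3) [:: 1; e ^+ (a * i); e ^+ ((d - a) * i)]`_j).
Proof.
elim: i => [|i IHi].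
  rewrite expr0 !muln0 expr0; apply/matrixP => x y; rewrite !mxE.
  by congr (_ *+ _); move: x; apply: ord3_ind.
rewrite exprS IHi /rho_tau -[_ * _]/(_ *m _) mulmx_diag; congr diag_mx.
apply/rowP; apply: ord3_ind; rewrite !mxE /= ?mul1r // -exprD mulnS //.
Qed.

(** The rotation multiplies the monomial by [e ^ (a (c1 - c2))], and [a] is
    invertible modulo [d]. *)
Lemma Gamma_invariant_xmon c0 c1 c2 :
  Gamma_invariant d a e (xmon k c0 c1 c2) = (c1 == c2 %[mod d]).
Proof.
have ed1 : e ^+ d = 1 := prim_expr_order e_prim.
have actE i : mx_act (rho_tau d a e ^+ i) (xmon k c0 c1 c2) =
    (e ^+ (i * (a * c1 + (d - a) * c2))) *: xmon k c0 c1 c2.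
  rewrite rho_tauX /mx_act.
  pose c (j : 'I_3) := [:: 1; e ^+ (a * i); e ^+ ((d - a) * i)]`_j.
  have -> : [tuple \sum_l (diag_mx (\row_j c j)) l j *: 'X_l | j < 3] =
      [tuple c j *: 'X_j | j < 3] :> 3.-tuple {mpoly k[3]}.
    apply: eq_mktuple => j; rewrite (bigD1 j) //= big1 ?addr0.
      by rewrite !mxE eqxx.
    by move=> l /negPf lj; rewrite !mxE lj scale0r.
  apply/mpolyP => m; rewrite mcoeff_comp_scale mcoeffZ xmonE mcoeffX.
  case: eqP => [<-|]; last by rewrite !mulr0.
  rewrite !mulr1 big_ord3 /= !mnmE /= expr1n mul1r -!exprM -exprD.
  by congr (_ ^+ _); lia.
have dvdE : (c1 == c2 %[mod d]) = (d %| a * c1 + (d - a) * c2)%N.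
  have -> : (d %| a * c1 + (d - a) * c2)%N = (a * c1 == a * c2 %[mod d])%N.
    rewrite -(eqn_modDr ((d - a) * c2)) -mulnDl subnKC; last exact: ltnW.
    by rewrite modnMr.
  case/orP: (leq_total c2 c1) => le_c; last rewrite eq_sym [RHS]eq_sym;
    by rewrite !eqn_mod_dvd ?leq_mul // -mulnBr Gauss_dvdr // coprime_sym.
rewrite dvdE; apply/forallP/idP => [inv|dvd i].
  have /eqP := inv (Ordinal d_gt1); rewrite actE mul1n => inv1.
  rewrite (prim_order_dvd e_prim) -subr_eq0.
  have : (e ^+ (a * c1 + (d - a) * c2) - 1) *: xmon k c0 c1 c2 = 0.
    by rewrite scalerBl scale1r inv1 subrr.
  by move/eqP; rewrite scaler_eq0 (negPf (xmon_neq0 _ _ _ _)) orbF.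
rewrite actE; suff /eqP-> : e ^+ (i * (a * c1 + (d - a) * c2)) == 1 by rewrite scale1r.
by rewrite -(prim_order_dvd e_prim) dvdn_mull.
Qed.

Lemma B2d_monomial i : (i <= d)%N -> xmon k (2 * d - 2 * i) i i \in B2d d a e.
Proof.
move=> le_id; rewrite mem_undup mem_cat; apply/orP; left.
by apply/mapP; exists i; rewrite // mem_iota.
Qed.

Lemma B2d_binomial c0 c1 c2 :
  (c0 + c1 + c2 = 2 * d)%N -> c1 != c2 -> c1 = c2 %[mod d] ->
  xmon k c0 c1 c2 + xmon k c0 c2 c1 \in B2d d a e.
Proof.
move=> sum_c ne_c eq_c; rewrite mem_undup mem_cat; apply/orP; right.
have [lt0 lt1 lt2] : [/\ c0 < (2 * d).+1, c1 < (2 * d).+1 & c2 < (2 * d).+1]%N.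
  by split; lia.
apply/mapP; exists (Ordinal lt0, Ordinal lt1, Ordinal lt2) => //.
by rewrite mem_filter mem_enum /= ne_c Gamma_invariant_xmon eq_c eqxx sum_c eqxx.
Qed.

Lemma B2dP p : reflect
  ((exists2 i, (i <= d)%N & p = xmon k (2 * d - 2 * i) i i) \/
   (exists c0 c1 c2, [/\ (c0 + c1 + c2 = 2 * d)%N, c1 != c2, c1 = c2 %[mod d]
      & p = xmon k c0 c1 c2 + xmon k c0 c2 c1]))
  (p \in B2d d a e).
Proof.
apply: (iffP idP) => [|[[i le_id ->]|[c0 [c1 [c2 [sum_c ne_c eq_c ->]]]]]]; last 2 first.
- exact: B2d_monomial.
- exact: B2d_binomial.
rewrite mem_undup mem_cat => /orP[/mapP[i]|/mapP[[[c0 c1] c2]]].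
  by rewrite mem_iota => le_id ->; left; exists i.
rewrite mem_filter Gamma_invariant_xmon /= => /andP[/and3P[/eqP sum_c ne_c /eqP eq_c] _ ->].
by right; exists c0, c1, c2.
Qed.

Lemma B2d_homog p : p \in B2d d a e -> p \is (2 * d).-homog.
Proof.
case/B2dP => [[i le_id ->]|[c0 [c1 [c2 [sum_c _ _ ->]]]]].
  have := xmon_homog k (2 * d - 2 * i) i i.
  by rewrite (_ : 2 * d - 2 * i + i + i = 2 * d)%N //; lia.
apply: rpredD; rewrite -sum_c; first exact: xmon_homog.
by rewrite addnAC; apply: xmon_homog.
Qed.

Lemma B2d_x0 : xmon k (2 * d) 0 0 \in B2d d a e.
Proof. by have := B2d_monomial (leq0n d); rewrite muln0 subn0. Qed.

Lemma B2d_x1x2 : xmon k 0 d d \in B2d d a e.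
Proof. by have := B2d_monomial (leqnn d); rewrite subnn. Qed.

Lemma B2d_x1Dx2 : xmon k 0 (2 * d) 0 + xmon k 0 0 (2 * d) \in B2d d a e.
Proof.
apply: B2d_binomial; rewrite ?addn0 // -?lt0n ?muln_gt0 ?(ltnW d_gt1) //.
by rewrite modnMl mod0n.
Qed.

(** Apart from the [d + 1] monomials, the residue condition forces the two
    exponents of a binomial to differ by [d] or by [2d]. *)
Lemma size_B2d : (3 <= d)%N -> (size (B2d d a e) <= 2 * d + 1)%N.
Proof.
move=> d_ge3.
pose s := [seq xmon k (2 * d - 2 * i) i i | i <- iota 0 d.+1] ++
  [seq xmon k (d - 2 * j) (d + j) j + xmon k (d - 2 * j) j (d + j) | j <- iota 0 (d./2).+1] ++
  [:: xmon k 0 (2 * d) 0 + xmon k 0 0 (2 * d)].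
apply: (@leq_trans (size s)); last first.
  by rewrite /s !size_cat !size_map !size_iota /=; lia.
apply: uniq_leq_size (undup_uniq _) _ => p.
case/B2dP => [[i le_id ->]|[c0 [c1 [c2 [sum_c ne_c eq_c ->]]]]].
  by rewrite mem_cat; apply/orP; left; apply/mapP; exists i; rewrite // mem_iota.
rewrite mem_cat; apply/orP; right.
wlog lt_c : c1 c2 sum_c ne_c eq_c / (c2 < c1)%N.
  move=> wl; have [lt_c|lt_c|eq_c12] := ltngtP c1 c2; last by rewrite eq_c12 eqxx in ne_c.
    by rewrite addrC; apply: wl => //; [lia|rewrite eq_sym].
  exact: wl.
have [t c1E] : exists t, c1 = (c2 + t * d)%N.
  have /dvdnP[t tE] : (d %| c1 - c2)%N by rewrite -eqn_mod_dvd ?eq_c // ltnW.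
  by exists t; lia.
have [t1|[t2 [c00 c20]]] : (t = 1 \/ t = 2 /\ c0 = 0 /\ c2 = 0)%N by nia.
  rewrite mem_cat; apply/orP; left; apply/mapP; exists c2.
    by rewrite mem_iota; lia.
  by congr (xmon _ _ _ _ + xmon _ _ _ _); lia.
rewrite mem_cat; apply/orP; right; rewrite inE c1E t2 c00 c20 add0n.
exact: eqxx.
Qed.

End Generators.

(** * Dihedral invariants and multiples of a linear form *)

Lemma prim_root_neq0 (k : fieldType) n (z : k) : n.-primitive_root z -> z != 0.
Proof.
move=> z_prim; have := prim_expr_order z_prim; apply: contra_eqN => /eqP->.
by rewrite expr0n gtn_eqF ?(prim_order_gt0 z_prim) // eq_sym oner_eq0.
Qed.

Section Relations.
Variables (k : fieldType) (d a : nat) (e : k).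
Hypotheses (e_prim : d.-primitive_root e) (a_d : coprime a d) (d_gt1 : (1 < d)%N).
Hypotheses (a_lt_d : (a < d)%N) (two_neq0 : 2%:R != 0 :> k).

Let I := ideal_gen (in_tuple (B2d d a e)).

Definition rotate (p : {mpoly k[3]}) : {mpoly k[3]} :=
  p \mPo [tuple ([:: 1; e; e^-1]`_i) *: 'X_i | i < 3].

Lemma rotateM p q : rotate (p * q) = rotate p * rotate q.
Proof. exact: rmorphM. Qed.

Lemma rotate_prod N (E : 'I_N -> {mpoly k[3]}) :
  rotate (\prod_i E i) = \prod_i rotate (E i).
Proof. exact: rmorph_prod. Qed.

(** A form fixed by the rotation involves only monomials fixed by the rotation;
    symmetrising these writes twice an invariant form through the generators. *)
Lemma invariant_mem_ideal (p : {mpoly k[3]}) :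
  p \is (2 * d).-homog -> rotate p = p -> msym swap12 p = p -> I p.
Proof.
move=> hp rp sp; have I_ideal : is_ideal I := ideal_gen_ideal _.
have [I0 ID IM] := I_ideal.
have e0 : e != 0 := prim_root_neq0 e_prim.
have residue m : p@_m != 0 -> m 1 = m 2 %[mod d].
  move=> pm; apply/eqP; rewrite -(eq_prim_root_expr e_prim).
  have /eqP := congr1 (mcoeff m) rp; rewrite mcoeff_comp_scale big_ord3 /=.
  rewrite -subr_eq0 -[X in _ - X]mul1r -mulrBl mulf_eq0 (negPf pm) orbF subr_eq0.
  rewrite expr1n mul1r exprVn; move/eqP => E.
  by rewrite -[e ^+ m 1](mulfVK (expf_neq0 (m 2) e0)) E mul1r.
have I_sym m : m \in msupp p -> I ('X_[m] + msym swap12 'X_[m]).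
  rewrite mcoeff_msupp => pm; rewrite mpolyX3E msym_xmon.
  have : mdeg m = (2 * d)%N by apply: (dhomog_mf hp); rewrite mcoeff_msupp.
  rewrite mdeg3 => deg_m; have res := residue m pm.
  have [m12|ne_m] := eqVneq (m 1) (m 2); last first.
    by apply: mem_ideal_gen; apply: B2d_binomial.
  rewrite m12; suff Ix : I (xmon k (m 0) (m 2) (m 2)) by apply: ID.
  apply: mem_ideal_gen; have -> : m 0 = (2 * d - 2 * m 2%R)%N by lia.
  by apply: B2d_monomial; lia.
have I2p : I (p + p).
  rewrite -{2}sp (mpolyE p) raddf_sum -big_split big_seq.
  apply: (ideal_sum _ I_ideal) => m /I_sym; rewrite /= msymZ -scalerDr -mul_mpolyC.
  exact: IM.
have -> : p = (2%:R^-1)%:MP * (p + p).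
  by rewrite mul_mpolyC -mulr2n -scaler_nat scalerA mulVf ?scale1r.
exact: IM.
Qed.

Definition lin3 (a0 a1 a2 : k) : {mpoly k[3]} := a0 *: 'X_0 + a1 *: 'X_1 + a2 *: 'X_2.

Lemma lin3_homog a0 a1 a2 : lin3 a0 a1 a2 \is 1.-homog.
Proof. by rewrite !rpredD // rpredZ // dhomogX /= mdeg1. Qed.

Lemma lin3_coeff a0 a1 a2 (i : 'I_3) : (lin3 a0 a1 a2)@_U_(i) = [:: a0; a1; a2]`_i.
Proof.
rewrite !mcoeffD !mcoeffZ !mcoeffXU; move: i.
by apply: ord3_ind; rewrite /= !(mulr0, mulr1, addr0, add0r).
Qed.

Lemma lin3_eta (L : {mpoly k[3]}) : L \is 1.-homog ->
  L = lin3 L@_U_(0) L@_U_(1) L@_U_(2).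
Proof.
move=> hL; apply/mpolyP => m; have [/mdeg1P[i /eqP->]|m1] := boolP (mdeg m == 1%N).
  by rewrite lin3_coeff; move: i; apply: ord3_ind.
by rewrite (dhomog_nemf_coeff hL m1) (dhomog_nemf_coeff (lin3_homog _ _ _) m1).
Qed.

Lemma lin3_neq0 a0 a1 a2 : lin3 a0 a1 a2 != 0 -> [|| a0 != 0, a1 != 0 | a2 != 0].
Proof.
apply: contraNT; rewrite !negb_or !negbK => /and3P[/eqP-> /eqP-> /eqP->].
by rewrite /lin3 !scale0r !addr0.
Qed.

Lemma rotate_lin3 a0 a1 a2 : rotate (lin3 a0 a1 a2) = lin3 a0 (a1 * e) (a2 / e).
Proof.
rewrite /rotate /lin3 !comp_mpolyD !comp_mpolyZ !comp_mpolyXU.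
by rewrite -!tnth_nth !tnth_mktuple /= !scalerA mulr1.
Qed.

Lemma swap_lin3 a0 a1 a2 : msym swap12 (lin3 a0 a1 a2) = lin3 a0 a2 a1.
Proof.
have sU i : msym swap12 'X_i = 'X_(swap12 i) :> {mpoly k[3]}.
  rewrite msymX; congr 'X_[_]; apply/mnmP => j; rewrite !mnmE tpermV.
  by rewrite -(inj_eq (@perm_inj _ swap12)) tpermK.
rewrite /lin3 !msymD !msymZ !sU tpermL tpermR tpermD // -!addrA.
by congr (_ + _); rewrite addrC.
Qed.

Lemma prod_shift (R : comNzRingType) N (E : nat -> R) :
  E N = E 0%N -> \prod_(i < N) E i.+1 = \prod_(i < N) E i.
Proof.
case: N => [|N] EN; first by rewrite !big_ord0.
by rewrite big_ord_recr big_ord_recl /= EN mulrC.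
Qed.

(** The product of the [2 * d] dihedral conjugates of [L] is invariant, and [L]
    is one of its factors: the product of the others is the form to look for. *)
Lemma relation_linear_form (L : {mpoly k[3]}) : L \is 1.-homog -> L != 0 ->
  exists f, [/\ f \is (2 * d - 1).-homog, f != 0 & I (L * f)].
Proof.
move=> hL L0; have e0 : e != 0 := prim_root_neq0 e_prim.
have ed : e ^+ d = 1 := prim_expr_order e_prim.
pose a0 := L@_U_(0); pose a1 := L@_U_(1); pose a2 := L@_U_(2).
have LE : L = lin3 a0 a1 a2 := lin3_eta hL.
(* The conjugates by the rotations, and by the rotations times the swap. *)
pose A i := lin3 a0 (a1 * e ^+ i) (a2 / e ^+ i).
pose B i := lin3 a0 (a2 / e ^+ i) (a1 * e ^+ i).
have rA i : rotate (A i) = A i.+1.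
  by rewrite rotate_lin3; congr lin3; rewrite exprSr ?invfM mulrA.
have rB i : rotate (B i.+1) = B i.
  by rewrite rotate_lin3; congr lin3; rewrite exprSr ?invfM; field; rewrite ?expf_neq0 ?e0.
have A0 : A 0%N = L by rewrite /A expr0 divr1 mulr1 -LE.
have Ad : A d = A 0%N by rewrite /A ed.
have Bd : B d = B 0%N by rewrite /B ed.
have lin_neq0 b0 b1 b2 : [|| b0 != 0, b1 != 0 | b2 != 0] -> lin3 b0 b1 b2 != 0.
  move=> nz; apply: contraTneq nz => l0.
  have c0 (i : 'I_3) : [:: b0; b1; b2]`_i = 0 by rewrite -lin3_coeff l0 mcoeff0.
  by have /= -> := c0 0; have /= -> := c0 1; have /= -> := c0 2; rewrite eqxx.
have a_neq0 : [|| a0 != 0, a1 != 0 | a2 != 0] by apply: lin3_neq0; rewrite -LE.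
have ei0 i : (e ^+ i == 0) = false by rewrite expf_eq0 (negPf e0) andbF.
have Anz i : A i != 0.
  by apply: lin_neq0; rewrite !(mulf_eq0, invr_eq0, ei0, orbF).
have Bnz i : B i != 0.
  by apply: lin_neq0; rewrite !(mulf_eq0, invr_eq0, ei0, orbF) [in X in _ || X]orbC.
have dE : d = d.-1.+1 by rewrite (ltn_predK d_gt1).
pose f := \prod_(i < d.-1) A i.+1 * \prod_(i < d) B i.
have LfE : L * f = \prod_(i < d) A i * \prod_(i < d) B i.
  by rewrite mulrA -A0; congr (_ * _); rewrite [in RHS]dE big_ord_recl.
have homA i : A i \is 1.-homog := lin3_homog _ _ _.
have homB i : B i \is 1.-homog := lin3_homog _ _ _.
exists f; split.
- have := dhomogM (dhomog_prod_ord (fun i : 'I_d.-1 => homA i.+1))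
    (dhomog_prod_ord (fun i : 'I_d => homB i)).
  by rewrite !muln1 (_ : d.-1 + d = 2 * d - 1)%N //; lia.
- by rewrite mulf_neq0 //; apply/prodf_neq0.
rewrite LfE; apply: invariant_mem_ideal.
- have := dhomogM (dhomog_prod_ord (fun i : 'I_d => homA i))
    (dhomog_prod_ord (fun i : 'I_d => homB i)).
  by rewrite !muln1 mul2n addnn.
- rewrite rotateM !rotate_prod; congr (_ * _).
    by under eq_bigr do rewrite rA; apply: prod_shift.
  rewrite -(prod_shift (E := fun i => rotate (B i))) ?Bd //.
  by apply: eq_bigr => i _; rewrite rB.
- rewrite msymM !rmorph_prod mulrC.
  by congr (_ * _); apply: eq_bigr => i _; apply: swap_lin3.
Qed.

End Relations.

(** * Finiteness of the morphism *)

Section Finiteness.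
Variables (k : fieldType) (n r delta : nat) (F : r.-tuple {mpoly k[n]}).
Hypothesis homF : forall i, tnth F i \is delta.-homog.

Let const : {rmorphism k -> {fraction {mpoly k[n]}}} := @tofrac {mpoly k[n]} \o @mpolyC n k.
Let chart i : {rmorphism {mpoly k[r]} -> {fraction {mpoly k[n]}}} :=
  mmap const (fun j => tofrac (tnth F j) / tofrac (tnth F i)).

Lemma chart_comorphismM i p q :
  chart_comorphism F i (p * q) = chart_comorphism F i p * chart_comorphism F i q.
Proof. exact: (rmorphM (chart i)). Qed.

Lemma chart_comorphismD i p q :
  chart_comorphism F i (p + q) = chart_comorphism F i p + chart_comorphism F i q.
Proof. exact: (rmorphD (chart i)). Qed.

Lemma chart_comorphism0 i : chart_comorphism F i 0 = 0.
Proof. exact: (rmorph0 (chart i)). Qed.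

Lemma chart_comorphismC i c : chart_comorphism F i c%:MP = tofrac c%:MP.
Proof. exact: (mmapC _ const). Qed.

Lemma chart_comorphismX i j :
  chart_comorphism F i 'X_j = tofrac (tnth F j) / tofrac (tnth F i).
Proof. by rewrite -[LHS]/(mmap const _ _) mmapX mmap1U. Qed.

(** If all monomials of degree at least [N] lie in the ideal of the [F_j], then a
    form [f] of large degree [t * delta] is [sum_j g_j F_j] with [g_j] of degree
    [(t - 1) * delta], so [f / F_i ^ t = sum_j (F_j / F_i) (g_j / F_i ^ (t - 1))].
    Descending on [t], the fractions with [t < N] of monomials generate. *)
Lemma finite_morphism_of_monomials N : (0 < delta)%N ->
  (forall m : 'X_{1..n}, (N <= mdeg m)%N -> ideal_gen F 'X_[m]) ->
  finite_morphism delta F.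
Proof.
move=> delta_gt0 Imon i Fi0; set y := tnth F i in Fi0.
pose J := ('I_N.+1 * 'X_{1..n < (N * delta).+1})%type.
pose frac (t : nat) (f : {mpoly k[n]}) : {fraction {mpoly k[n]}} :=
  tofrac f / tofrac y ^+ t.
pose g (u : J) := if mdeg u.2 == (u.1 * delta)%N then frac u.1 'X_[u.2] else 0.
exists #|{: J}|, (fun j => g (enum_val j)); split.
  move=> j; rewrite /g; case: eqP => [deg_u|_]; last first.
    by exists 0%N, 0; rewrite rpred0 tofrac0 mul0r.
  exists (enum_val j).1, 'X_[(enum_val j).2]; split=> //.
  by rewrite dhomogX /= deg_u.
pose M z := exists b : 'I_#|{: J}| -> {mpoly k[r]},
  z = \sum_j chart_comorphism F i (b j) * g (enum_val j).
have MD z w : M z -> M w -> M (z + w).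
  move=> [b ->] [c ->]; exists (fun j => b j + c j); rewrite -big_split.
  by apply: eq_bigr => j _; rewrite chart_comorphismD mulrDl.
have MM c z : M z -> M (chart_comorphism F i c * z).
  move=> [b ->]; exists (fun j => c * b j); rewrite mulr_sumr.
  by apply: eq_bigr => j _; rewrite chart_comorphismM mulrA.
have M0 : M 0.
  by exists (fun=> 0); rewrite big1 // => j _; rewrite chart_comorphism0 mul0r.
have Mg u : M (g u).
  exists (fun j => (j == enum_rank u)%:R); rewrite (bigD1 (enum_rank u)) //=.
  rewrite eqxx -[1%:R]mpolyC1 chart_comorphismC mpolyC1 tofrac1 mul1r enum_rankK.
  by rewrite big1 ?addr0 // => j /negPf->; rewrite chart_comorphism0 mul0r.
move=> _ [t [f [hf ->]]]; rewrite -/(frac t f); change (M (frac t f)).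
have fracD s p q : frac s (p + q) = frac s p + frac s q by rewrite /frac tofracD mulrDl.
have frac0 s : frac s 0 = 0 by rewrite /frac tofrac0 mul0r.
have frac_sum s (T : Type) (l : seq T) (P : pred T) (E : T -> {mpoly k[n]}) :
    frac s (\sum_(x <- l | P x) E x) = \sum_(x <- l | P x) frac s (E x).
  exact: (big_morph (frac s) (fracD s) (frac0 s)).
have y0 : tofrac y != 0 by rewrite tofrac_eq0.
have small s p : (s <= N)%N -> p \is (s * delta).-homog -> M (frac s p).
  move=> le_sN hp; rewrite (mpolyE p) frac_sum big_seq.
  apply: big_ind => // m mp; have deg_m := dhomog_mf hp mp.
  have lt_m : (mdeg m < (N * delta).+1)%N by rewrite deg_m ltnS leq_mul2r le_sN orbT.
  have -> : frac s (p@_m *: 'X_[m]) =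
      chart_comorphism F i (p@_m)%:MP * g (Ordinal (le_sN : s < N.+1)%N, BMultinom lt_m).
    by rewrite /g /= deg_m eqxx chart_comorphismC /frac mulrA -tofracM mul_mpolyC.
  exact/MM/Mg.
elim: t f hf => [|t IHt] f hf; first exact: small.
have [/small|lt_Nt] := leqP t.+1 N; first exact.
have If : ideal_gen F f.
  rewrite (mpolyE f) big_seq; apply: (ideal_sum _ (ideal_gen_ideal F)) => m mf.
  have [_ _ IM] := ideal_gen_ideal F; rewrite -mul_mpolyC; apply/IM/Imon.
  rewrite (dhomog_mf hf mf); apply: leq_trans (leq_pmulr _ delta_gt0).
  exact: ltnW.
have [c fE] := If.
have {}fE : f = \sum_j pihomog mdeg (t * delta) (c j) * tnth F j.
  rewrite -(pihomog_dE hf) fE raddf_sum; apply: eq_bigr => j _ /=.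
  by rewrite mulSnr pihomogM.
rewrite fE frac_sum; apply: big_ind => // j _.
have -> : frac t.+1 (pihomog mdeg (t * delta) (c j) * tnth F j) =
    chart_comorphism F i 'X_j * frac t (pihomog mdeg (t * delta) (c j)).
  by rewrite chart_comorphismX /frac tofracM exprS invfM -/y; ring.
exact/MM/IHt/pihomogP.
Qed.

End Finiteness.

(** * Pairs with equal symmetric functions *)

Section Fibres.
Variables (k : closedFieldType) (d : nat).
Hypotheses (d_gt0 : (0 < d)%N) (two_neq0 : 2%:R != 0 :> k).

Lemma closed_nthroot n (c : k) : (0 < n)%N -> exists z, z ^+ n = c.
Proof.
move=> n_gt0; have /closed_rootP[z] : size ('X^n - c%:P : {poly k}) != 1%N.
  by rewrite size_XnsubC // eqSS -lt0n.
by rewrite rootE !hornerE subr_eq0 => /eqP; exists z.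
Qed.

Lemma same_sum_prod (u v x y : k) : u + v = x + y -> u * v = x * y ->
  (u = x /\ v = y) \/ (u = y /\ v = x).
Proof.
move=> sum_uv prod_uv; have : (u - x) * (u - y) == 0.
  apply/eqP; transitivity (u ^+ 2 - u * (x + y) + x * y); first by ring.
  by rewrite -sum_uv -prod_uv; ring.
rewrite mulf_eq0 !subr_eq0 => /orP[] /eqP uE; [left|right]; split=> //.
  by apply: (addrI u); rewrite sum_uv uE.
by apply: (addrI u); rewrite sum_uv uE addrC.
Qed.

Lemma eq_expr_eq0 n (x y : k) : (0 < n)%N -> y ^+ n = x ^+ n -> (y == 0) = (x == 0).
Proof.
by move=> n_gt0 p; have := congr1 (fun t => t == 0) p; rewrite !expf_eq0 n_gt0.
Qed.

(** The first coordinate that does not vanish determines the rotation [z], and the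
    product fixes the other coordinate. *)
Lemma torus_orbit (x1 x2 y1 y2 : k) :
  x1 * x2 = y1 * y2 -> y1 ^+ d = x1 ^+ d -> y2 ^+ d = x2 ^+ d ->
  exists z, [/\ z ^+ d = 1, y1 = z * x1 & y2 = z^-1 * x2].
Proof.
move=> prodE p1 p2.
have zero (x y : k) : y ^+ d = x ^+ d -> x = 0 -> y = 0.
  by move=> p x0; apply/eqP; rewrite (eq_expr_eq0 d_gt0 p) x0.
have [x10|x1n] := eqVneq x1 0; last first.
  have y1n : y1 != 0 by apply: contraNneq x1n => y10; rewrite (zero _ _ (esym p1) y10).
  exists (y1 / x1); split; first by rewrite expr_div_n p1 divff ?expf_neq0.
    by rewrite divfK.
  by rewrite invf_div; apply: (mulfI y1n); rewrite -prodE; field; rewrite y1n.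
rewrite x10 (zero _ _ p1 x10).
have [x20|x2n] := eqVneq x2 0.
  by exists 1; rewrite expr1n x20 (zero _ _ p2 x20) !mulr0.
have y2n : y2 != 0 by apply: contraNneq x2n => y20; rewrite (zero _ _ (esym p2) y20).
exists (x2 / y2); rewrite mulr0 invf_div divfK //; split=> //.
by rewrite expr_div_n p2 divff ?expf_neq0.
Qed.

(** Squaring permutes the [d]-th roots of unity when [d] is odd, and maps them onto
    the [m]-th roots of unity when [d = 2 m]. *)
Lemma sqrt_of_root_of_unity (r : k) : r ^+ d = 1 ->
  (forall m, d = (2 * m)%N -> r ^+ m = 1) -> exists2 z, z ^+ d = 1 & z ^+ 2 = r.
Proof.
move=> rd rm; have := odd_double_half d; case: odd => dE.
  exists (r ^+ (d./2).+1); first by rewrite exprAC rd expr1n.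
  by rewrite -exprM (_ : (d./2).+1 * 2 = d.+1)%N ?exprS ?rd ?mulr1 //; lia.
have [z z2] := closed_nthroot r (isT : (0 < 2)%N); exists z => //.
have d2 : d = (2 * d./2)%N by lia.
by rewrite d2 exprM z2 rm.
Qed.

(** On the line [x_0 = 0] the scalars are available besides the rotations, and
    [(x_1 : x_2)] is moved to [(s x_1 : t x_2)] by the rotation [z] as soon as
    [z ^ 2 = s / t].  For [d = 2 m] this needs [(s / t) ^ m = 1]; otherwise
    [(s / t) ^ m = -1], the invariant [(x_1 x_2) ^ m (x_1 ^ d + x_2 ^ d)] vanishes,
    and the reflection composed with a rotation does it. *)
Lemma line_orbit (x1 x2 y1 y2 : k) :
  y1 ^+ (2 * d) = x1 ^+ (2 * d) -> y2 ^+ (2 * d) = x2 ^+ (2 * d) ->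
  y1 ^+ d * y2 ^+ d = x1 ^+ d * x2 ^+ d ->
  (forall m, d = (2 * m)%N ->
     (y1 * y2) ^+ m * (y1 ^+ d + y2 ^+ d) = (x1 * x2) ^+ m * (x1 ^+ d + x2 ^+ d)) ->
  exists z b c, [/\ z ^+ d = 1, c != 0,
    y1 = c * (z * (if b then x2 else x1)) & y2 = c * (z^-1 * (if b then x1 else x2))].
Proof.
move=> p1 p2 pE evenE; have d2_gt0 : (0 < 2 * d)%N by rewrite muln_gt0.
have same0 (x y : k) := @eq_expr_eq0 (2 * d) x y d2_gt0.
have [x10|x1n] := eqVneq x1 0.
  have y10 : y1 = 0 by apply/eqP; rewrite (same0 _ _ p1) x10.
  have [x20|x2n] := eqVneq x2 0.
    have y20 : y2 = 0 by apply/eqP; rewrite (same0 _ _ p2) x20.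
    by exists 1, false, 1; rewrite expr1n oner_neq0 x10 x20 y10 y20 !mulr0.
  exists 1, false, (y2 / x2); rewrite expr1n x10 y10 !mulr0 invr1 mul1r divfK //.
  by split=> //; rewrite mulf_neq0 ?invr_eq0 ?(same0 _ _ p2).
have y1n : y1 != 0 by rewrite (same0 _ _ p1).
have [x20|x2n] := eqVneq x2 0.
  have y20 : y2 = 0 by apply/eqP; rewrite (same0 _ _ p2) x20.
  exists 1, false, (y1 / x1); rewrite expr1n x20 y20 !mulr0 mul1r divfK //.
  by split=> //; rewrite mulf_neq0 ?invr_eq0.
have y2n : y2 != 0 by rewrite (same0 _ _ p2).
(* A square root [z] of [(y1 / u1) / (y2 / u2)] gives the scalar [(y1 / u1) / z]. *)
have orbit (u1 u2 : k) : u1 != 0 -> u2 != 0 -> (y1 * u2) ^+ d = (u1 * y2) ^+ d ->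
    (forall m, d = (2 * m)%N -> (y1 * u2) ^+ m = (u1 * y2) ^+ m) ->
    exists z c, [/\ z ^+ d = 1, c != 0, y1 = c * (z * u1) & y2 = c * (z^-1 * u2)].
  move=> u1n u2n rd rm; pose r := (y1 * u2) / (u1 * y2).
  have uyn : u1 * y2 != 0 by rewrite mulf_neq0.
  have [z zd z2] : exists2 z, z ^+ d = 1 & z ^+ 2 = r.
    apply: sqrt_of_root_of_unity => [|m /rm rm']; rewrite expr_div_n ?rd ?rm' divff //;
      exact: expf_neq0.
  have zn : z != 0.
    by apply: contra_eqN zd => /eqP->; rewrite expr0n gtn_eqF // eq_sym oner_neq0.
  exists z, (y1 / u1 / z); split=> //.
  - by rewrite !mulf_neq0 ?invr_eq0.
  - by field; rewrite u1n zn.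
  - apply/eqP; rewrite -subr_eq0; apply/eqP.
    transitivity (y2 * (1 - r / z ^+ 2)); last first.
      by rewrite z2 divff ?subrr ?mulr0 // /r mulf_neq0 ?invr_eq0 ?mulf_neq0.
    by rewrite /r; field; rewrite u1n zn y2n.
have rd : (y1 * x2) ^+ d = (x1 * y2) ^+ d.
  rewrite !exprMn; apply: (mulIf (expf_neq0 d y2n)).
  rewrite mulrAC pE -!mulrA -!expr2 -!exprM ![(d * 2)%N]mulnC p2.
  by rewrite mul2n -addnn exprD mulrA.
have [m_ok|/not_all_ex_not[m m_bad]] :=
  classic (forall m, d = (2 * m)%N -> (y1 * x2) ^+ m = (x1 * y2) ^+ m).
  by have [z [c cP]] := orbit x1 x2 x1n x2n rd m_ok; exists z, false, c.
have [dE /eqP rm_neq] := imply_to_and _ _ m_bad.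
have rm_opp : (y1 * x2) ^+ m = - (x1 * y2) ^+ m.
  move: rd; rewrite dE mulnC !exprM => /eqP.
  by rewrite eqf_sqr (negPf rm_neq) => /eqP.
have pE2 j : j ^+ d = (j ^+ m) ^+ 2 :> k by rewrite dE mulnC exprM.
move: rm_opp; rewrite !exprMn => rm_opp.
have x_opp : x1 ^+ d + x2 ^+ d = 0.
  have pqn : x1 ^+ m * x2 ^+ m != 0 by rewrite mulf_neq0 ?expf_neq0.
  have q4 : (y2 ^+ m) ^+ 4 = (x2 ^+ m) ^+ 4.
    by rewrite -!exprM (_ : m * 4 = 2 * d)%N //; lia.
  (* Multiplied by [x2 ^ (3 m)], the left side of [evenE] depends on [y1] only
     through [y1 ^ m * x2 ^ m], which is [- (x1 ^ m * y2 ^ m)]. *)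
  have := evenE m dE; rewrite !pE2 !exprMn => /(congr1 ( *%R ((x2 ^+ m) ^+ 3))).
  have -> : (x2 ^+ m) ^+ 3 * (y1 ^+ m * y2 ^+ m * ((y1 ^+ m) ^+ 2 + (y2 ^+ m) ^+ 2)) =
      (y1 ^+ m * x2 ^+ m) * y2 ^+ m *
      ((y1 ^+ m * x2 ^+ m) ^+ 2 + (y2 ^+ m) ^+ 2 * (x2 ^+ m) ^+ 2).
    by ring.
  rewrite rm_opp.
  have -> : - (x1 ^+ m * y2 ^+ m) * y2 ^+ m *
      ((- (x1 ^+ m * y2 ^+ m)) ^+ 2 + (y2 ^+ m) ^+ 2 * (x2 ^+ m) ^+ 2) =
      - (x1 ^+ m * ((x1 ^+ m) ^+ 2 + (x2 ^+ m) ^+ 2) * (y2 ^+ m) ^+ 4) by ring.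
  rewrite q4 => /eqP; rewrite eq_sym -subr_eq0.
  have -> : (x2 ^+ m) ^+ 3 * (x1 ^+ m * x2 ^+ m * ((x1 ^+ m) ^+ 2 + (x2 ^+ m) ^+ 2)) -
      - (x1 ^+ m * ((x1 ^+ m) ^+ 2 + (x2 ^+ m) ^+ 2) * (x2 ^+ m) ^+ 4) =
      2%:R * (x1 ^+ m * x2 ^+ m) * (x2 ^+ m) ^+ 3 * ((x1 ^+ m) ^+ 2 + (x2 ^+ m) ^+ 2) by ring.
  rewrite mulf_eq0 => /orP[|/eqP//].
  by rewrite !mulf_eq0 (negPf two_neq0) !expf_eq0 (negPf x1n) (negPf x2n) !andbF.
have rm' : (y1 * x1) ^+ m = (x2 * y2) ^+ m.
  rewrite !exprMn; apply: (mulIf (expf_neq0 m x2n)).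
  rewrite mulrAC rm_opp; move: x_opp; rewrite !pE2 => /eqP; rewrite addr_eq0 => /eqP p2E.
  transitivity (- (x1 ^+ m) ^+ 2 * y2 ^+ m); first by ring.
  by rewrite p2E; ring.
have [z [c cP]] : exists z c,
    [/\ z ^+ d = 1, c != 0, y1 = c * (z * x2) & y2 = c * (z^-1 * x1)].
  apply: orbit => // [|m' dE']; first by rewrite pE2 rm' -pE2.
  by rewrite (_ : m' = m) //; lia.
by exists z, true, c.
Qed.

End Fibres.

(** * The dihedral action and its orbits *)

Section Action.
Variable k : closedFieldType.
Implicit Types (z w : k) (b c : bool) (v : 'rV[k]_3).

(** The pairs [(z, b)] with [z ^+ d = 1] are coordinates on the dihedral group:
    the reflection, if [b] holds, is applied before the rotation by [z]. *)
Definition dih_forms z b : 3.-tuple {mpoly k[3]} :=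
  [tuple [:: 'X_0; z *: 'X_(if b then 2 else 1); z^-1 *: 'X_(if b then 1 else 2)]`_i
    | i < 3].

Definition dih z b v : 'rV[k]_3 :=
  \row_(i < 3) [:: v 0 0; z * v 0 (if b then 2 else 1); z^-1 * v 0 (if b then 1 else 2)]`_i.

Lemma eval_dih_forms z b v : eval_forms (dih_forms z b) v = dih z b v.
Proof.
apply/rowP; apply: ord3_ind; rewrite !mxE tnth_mktuple /= ?mevalZ mevalXU //.
Qed.

Lemma dih_forms_homog z b i : tnth (dih_forms z b) i \is 1.-homog.
Proof.
rewrite tnth_mktuple; move: i.
by apply: ord3_ind; rewrite /= ?dhomogZ // dhomogX /= mdeg1.
Qed.

Lemma dih0 z b v : (dih z b v) 0 0 = v 0 0.
Proof. by rewrite mxE. Qed.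

Lemma dih1 z b v : (dih z b v) 0 1 = z * v 0 (if b then 2 else 1).
Proof. by rewrite mxE. Qed.

Lemma dih2 z b v : (dih z b v) 0 2 = z^-1 * v 0 (if b then 1 else 2).
Proof. by rewrite mxE. Qed.

Definition dihE := (dih0, dih1, dih2).

Lemma dihM z b w c v :
  dih z b (dih w c v) = dih (z * (if b then w^-1 else w)) (b (+) c) v.
Proof.
apply/rowP; apply: ord3_ind; rewrite !dihE //; case: b; case: c;
  by rewrite !dihE /= ?invfM ?invrK mulrA.
Qed.

Lemma dih_id v : dih 1 false v = v.
Proof. by apply/rowP; apply: ord3_ind; rewrite !dihE ?invr1 ?mul1r. Qed.

Lemma dih_scale z b (c : k) v : dih z b (c *: v) = c *: dih z b v.
Proof. by rewrite -!eval_dih_forms (eval_forms_scale _ _ (dih_forms_homog z b)) expr1. Qed.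

Lemma dih_neq0 z b v : z != 0 -> v != 0 -> dih z b v != 0.
Proof.
move=> z0; apply: contraNneq => v0.
have := dihM (if b then z else z^-1) b z b v; rewrite v0 addbb.
have -> : (if b then z else z^-1) * (if b then z^-1 else z) = 1.
  by case: b {v0}; rewrite ?mulfV ?mulVf.
have -> : dih (if b then z else z^-1) b 0 = 0.
  by rewrite -[X in dih _ _ X](scale0r (0 : 'rV_3)) dih_scale scale0r.
by rewrite dih_id => <-.
Qed.

End Action.

Section Invariance.
Variables (k : closedFieldType) (d a : nat) (e : k).
Hypotheses (e_prim : d.-primitive_root e) (a_d : coprime a d) (d_gt1 : (1 < d)%N).
Hypotheses (a_lt_d : (a < d)%N) (two_neq0 : 2%:R != 0 :> k).

Lemma root_expr_mod (z : k) c1 c2 : z ^+ d = 1 -> c1 = c2 %[mod d] -> z ^+ c1 = z ^+ c2.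
Proof. by move=> zd eq_c; rewrite -(expr_mod _ zd) eq_c expr_mod. Qed.

Lemma root_neq0 (z : k) : z ^+ d = 1 -> z != 0.
Proof.
by move=> zd; apply: contra_eqN zd => /eqP->;
  rewrite expr0n gtn_eqF ?(ltnW d_gt1) // eq_sym oner_neq0.
Qed.

Lemma meval_xmon_dih (z : k) b (v : 'rV[k]_3) c0 c1 c2 : z ^+ d = 1 -> c1 = c2 %[mod d] ->
  (xmon k c0 c1 c2).@[fun j => dih z b v 0 j] =
  (xmon k c0 (if b then c2 else c1) (if b then c1 else c2)).@[fun j => v 0 j].
Proof.
move=> zd eq_c; have z0 := root_neq0 zd.
rewrite !meval_xmon !dihE !exprMn exprVn -(root_expr_mod zd eq_c).
have zc0 := expf_neq0 c1 z0.
by case: b; field.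
Qed.

Lemma B2d_dih p (z : k) b (v : 'rV[k]_3) : z ^+ d = 1 -> p \in B2d d a e ->
  p.@[fun j => dih z b v 0 j] = p.@[fun j => v 0 j].
Proof.
move=> zd /(B2dP e_prim a_d d_gt1 a_lt_d)[[i _ ->]|[c0 [c1 [c2 [_ _ eq_c ->]]]]].
  by rewrite meval_xmon_dih //; case: b.
rewrite !mevalD !meval_xmon_dih //; case: b => //.
by rewrite addrC.
Qed.

(** Where [x_0 <> 0], scaling makes the values of [x_0] equal, and the generators
    then determine [x_1 x_2] and [x_1 ^ d + x_2 ^ d], hence the unordered pair of
    the [d]-th powers of [x_1] and [x_2].  Where [x_0 = 0], they determine the
    unordered pair of the powers of exponent [2 d]. *)
Lemma B2d_separates (x y : 'rV[k]_3) :
  (forall p, p \in B2d d a e -> p.@[fun j => x 0 j] = p.@[fun j => y 0 j]) ->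
  exists z b c, [/\ z ^+ d = 1, c != 0 & y = c *: dih z b x].
Proof.
move=> eq_xy; have d_gt0 := ltnW d_gt1.
have mono i : (i <= d)%N ->
    x 0 0 ^+ (2 * d - 2 * i) * x 0 1 ^+ i * x 0 2 ^+ i =
    y 0 0 ^+ (2 * d - 2 * i) * y 0 1 ^+ i * y 0 2 ^+ i.
  by move=> le_id; rewrite -!(meval_xmon (k := k)); apply/eq_xy/B2d_monomial.
have bino c0 c1 c2 : (c0 + c1 + c2 = 2 * d)%N -> c1 != c2 -> c1 = c2 %[mod d] ->
    x 0 0 ^+ c0 * x 0 1 ^+ c1 * x 0 2 ^+ c2 + x 0 0 ^+ c0 * x 0 1 ^+ c2 * x 0 2 ^+ c1 =
    y 0 0 ^+ c0 * y 0 1 ^+ c1 * y 0 2 ^+ c2 + y 0 0 ^+ c0 * y 0 1 ^+ c2 * y 0 2 ^+ c1.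
  move=> sum_c ne_c eq_c; rewrite -!(meval_xmon (k := k)) -!mevalD.
  exact/eq_xy/(B2d_binomial e_prim).
have row3 (u v : 'rV[k]_3) : u 0 0 = v 0 0 -> u 0 1 = v 0 1 -> u 0 2 = v 0 2 -> u = v.
  by move=> *; apply/rowP; apply: ord3_ind.
have m0 : y 0 0 ^+ (2 * d) = x 0 0 ^+ (2 * d).
  by have := mono 0%N (leq0n d); rewrite muln0 subn0 !expr0 !mulr1.
have d2_gt0 : (0 < 2 * d)%N by rewrite muln_gt0.
have [x0|x0n] := eqVneq (x 0 0) 0.
  have y0 : y 0 0 = 0 by apply/eqP; rewrite (eq_expr_eq0 d2_gt0 m0) x0.
  have prodE : y 0 1 ^+ d * y 0 2 ^+ d = x 0 1 ^+ d * x 0 2 ^+ d.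
    by have := mono d (leqnn d); rewrite subnn !expr0 !mul1r.
  have sumE : y 0 1 ^+ (2 * d) + y 0 2 ^+ (2 * d) = x 0 1 ^+ (2 * d) + x 0 2 ^+ (2 * d).
    have := bino 0%N (2 * d)%N 0%N; rewrite !expr0 !mul1r !mulr1 => -> //.
    - by rewrite addn0.
    - by rewrite -lt0n.
    - by rewrite modnMl mod0n.
  have evenE m : d = (2 * m)%N ->
      (y 0 1 * y 0 2) ^+ m * (y 0 1 ^+ d + y 0 2 ^+ d) =
      (x 0 1 * x 0 2) ^+ m * (x 0 1 ^+ d + x 0 2 ^+ d).
    move=> dE; have := bino 0%N (m + d)%N m; rewrite !expr0 !mul1r modnDr => E.
    have {}E : x 0 1 ^+ (m + d) * x 0 2 ^+ m + x 0 1 ^+ m * x 0 2 ^+ (m + d) =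
        y 0 1 ^+ (m + d) * y 0 2 ^+ m + y 0 1 ^+ m * y 0 2 ^+ (m + d).
      by apply: E => //; lia.
    rewrite !exprD in E; rewrite !exprMn.
    by apply: etrans (etrans (esym E) _); ring.
  have prod2E : y 0 1 ^+ (2 * d) * y 0 2 ^+ (2 * d) = x 0 1 ^+ (2 * d) * x 0 2 ^+ (2 * d).
    by rewrite mul2n -addnn !exprD mulrACA prodE mulrACA.
  case: (same_sum_prod sumE prod2E) => -[p1 p2].
    have [z [b [c [zd c0 y1E y2E]]]] := line_orbit d_gt0 two_neq0 p1 p2 prodE evenE.
    exists z, b, c; split=> //; apply: row3; rewrite mxE dihE ?x0 ?mulr0 //.
      by rewrite y1E; case: b {y1E y2E}.
    by rewrite y2E; case: b {y1E y2E}.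
  have [|m dE|z [b [c [zd c0 y1E y2E]]]] := line_orbit d_gt0 two_neq0 p1 p2.
  - by rewrite prodE mulrC.
  - by rewrite evenE // [x 0 1 * _]mulrC [X in _ * X]addrC.
  exists z, (~~ b), c; split=> //; apply: row3; rewrite mxE dihE ?x0 ?mulr0 //.
    by rewrite y1E; case: b {y1E y2E}.
  by rewrite y2E; case: b {y1E y2E}.
(* The scalar that makes the values of [x_0] equal. *)
pose s := y 0 0 / x 0 0.
have y0n : y 0 0 != 0 by rewrite (eq_expr_eq0 d2_gt0 m0).
have sn : s != 0 by rewrite mulf_neq0 ?invr_eq0.
pose u1 := y 0 1 / s; pose u2 := y 0 2 / s.
have y0E : y 0 0 = s * x 0 0 by rewrite divfK.
have y1E : y 0 1 = s * u1 by rewrite mulrC divfK.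
have y2E : y 0 2 = s * u2 by rewrite mulrC divfK.
have s2d : s ^+ (2 * d) = 1 by rewrite expr_div_n m0 divff ?expf_neq0.
clearbody u1 u2; clearbody s.
have prodE : u1 * u2 = x 0 1 * x 0 2.
  have := mono 1%N d_gt0; rewrite y0E y1E y2E !expr1; set N := (_ - _)%N => E.
  have NE : (2 * d = N + 2)%N by rewrite /N; lia.
  apply: (mulfI (expf_neq0 N x0n)); rewrite [RHS]mulrA E exprMn.
  transitivity (s ^+ (2 * d) * (x 0 0 ^+ N * (u1 * u2))); first by rewrite s2d mul1r.
  by rewrite NE exprD; ring.
have sumE : u1 ^+ d + u2 ^+ d = x 0 1 ^+ d + x 0 2 ^+ d.
  have := bino d d 0%N; rewrite y0E y1E y2E !expr0 !mulr1 !exprMn => E.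
  apply: (mulfI (expf_neq0 d x0n)); rewrite [RHS]mulrDr E -?lt0n //; first last.
  - by rewrite modnn mod0n.
  - by lia.
  transitivity (s ^+ (2 * d) * (x 0 0 ^+ d * (u1 ^+ d + u2 ^+ d))).
    by rewrite s2d mul1r.
  by rewrite mul2n -addnn exprD; ring.
have orbit b : u1 ^+ d = x 0 (if b then 2 else 1) ^+ d ->
    u2 ^+ d = x 0 (if b then 1 else 2) ^+ d ->
    exists z b c, [/\ z ^+ d = 1, c != 0 & y = c *: dih z b x].
  move=> p1 p2; have [|z [zd z1 z2]] := torus_orbit d_gt0 _ p1 p2.
    by rewrite prodE; case: b {p1 p2}; rewrite // mulrC.
  exists z, b, s; split=> //; apply: row3; rewrite mxE dihE //.
    by rewrite -z1.
  by rewrite -z2.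
have prod2E : u1 ^+ d * u2 ^+ d = x 0 1 ^+ d * x 0 2 ^+ d by rewrite -!exprMn prodE.
by case: (same_sum_prod sumE prod2E) => -[p1 p2]; 
  [apply: (orbit false)|apply: (orbit true)].
Qed.

End Invariance.

(** * Monomials of large degree *)

(** Where the generators vanish, so does a power of each variable. *)
Lemma no_common_zero_of_monomials (k : closedFieldType) n r
    (F : r.-tuple {mpoly k[n]}) N :
  (forall m : 'X_{1..n}, (N <= mdeg m)%N -> ideal_gen F 'X_[m]) ->
  forall v : 'rV[k]_n, v != 0 -> eval_forms F v != 0.
Proof.
move=> Imon v; apply: contraNneq => Fv; apply/eqP/rowP => i; rewrite mxE.
have [|c cE] := Imon (U_(i) *+ N.+1)%MM; first by rewrite mdegMn mdeg1 mul1n leqnSn.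
have : 'X_[U_(i) *+ N.+1].@[fun j => v 0 j] = 0 :> k.
  rewrite cE rmorph_sum big1 // => j _.
  by rewrite rmorphM -[X in _ * X]/((tnth F j).@[_]) -eval_formsE Fv mxE mulr0.
by rewrite -mpolyXn rmorphXn /= mevalXU => /eqP; rewrite expf_eq0 => /andP[_ /eqP].
Qed.

(** [x_1 ^ (3 d) = x_1 ^ d (x_1 ^ (2 d) + x_2 ^ (2 d)) - x_2 ^ d (x_1 x_2) ^ d],
    and a monomial of degree at least [8 d] is divisible by [x_0 ^ (2 d)], by
    [x_1 ^ (3 d)] or by [x_2 ^ (3 d)]. *)
Lemma B2d_large_monomials (k : fieldType) d a (e : k) :
  d.-primitive_root e -> coprime a d -> (1 < d)%N -> (a < d)%N ->
  forall m : 'X_{1..3}, (8 * d <= mdeg m)%N ->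
    ideal_gen (in_tuple (B2d d a e)) 'X_[m].
Proof.
move=> e_prim a_d d_gt1 a_lt_d m; rewrite mdeg3 mpolyX3E.
move: (m 0) (m 1) (m 2) => m0 m1 m2 deg_m.
set I := ideal_gen _; have [I0 ID IM] : is_ideal I := ideal_gen_ideal _.
have Ix0 : I (xmon k (2 * d) 0 0) by apply/mem_ideal_gen/B2d_x0.
have Ix12 : I (xmon k 0 d d) by apply/mem_ideal_gen/B2d_x1x2.
have Isum : I (xmon k 0 (2 * d) 0 + xmon k 0 0 (2 * d)).
  exact/mem_ideal_gen/(B2d_x1Dx2 e_prim).
have d3 : (d + 2 * d = 3 * d)%N by lia.
have d2 : (d + d = 2 * d)%N by lia.
have Ix1 : I (xmon k 0 (3 * d) 0).
  have -> : xmon k 0 (3 * d) 0 = xmon k 0 d 0 * (xmon k 0 (2 * d) 0 + xmon k 0 0 (2 * d)) +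
      (- xmon k 0 0 d) * xmon k 0 d d.
    by rewrite mulrDr mulNr !xmonM !addn0 !add0n d3 d2 addrK.
  by apply: ID; apply: IM.
have Ix2 : I (xmon k 0 0 (3 * d)).
  have -> : xmon k 0 0 (3 * d) = xmon k 0 0 d * (xmon k 0 (2 * d) 0 + xmon k 0 0 (2 * d)) +
      (- xmon k 0 d 0) * xmon k 0 d d.
    by rewrite mulrDr mulNr !xmonM !addn0 !add0n d3 d2 addrC addKr.
  by apply: ID; apply: IM.
have [le0|lt0] := leqP (2 * d) m0.
  by rewrite -(subnK le0) -[m1]addn0 -[m2]addn0 -xmonM; apply: IM.
have [le1|lt1] := leqP (3 * d) m1.
  by rewrite -(subnK le1) -[m0]addn0 -[m2]addn0 -xmonM; apply: IM.
have le2 : (3 * d <= m2)%N by lia.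
by rewrite -(subnK le2) -[m0]addn0 -[m1]addn0 -xmonM; apply: IM.
Qed.

(** * The group of deck transformations *)

(** With the rotation index turned into a root of unity, the multiplication rule
    becomes that of the maps [dih]. *)
Lemma dihedral_root_coordinates (k : fieldType) d (e : k) :
  (1 < d)%N -> d.-primitive_root e ->
  exists (Z : 'D_(2 * d) -> k) (B : 'D_(2 * d) -> bool),
  [/\ forall g, Z g ^+ d = 1,
      forall g h, Z (g * h)%g = Z g * (if B g then (Z h)^-1 else Z h) /\
                  B (g * h)%g = B g (+) B h,
      forall g h, Z g = Z h -> B g = B h -> g = h
    & forall z b, z ^+ d = 1 -> exists g, Z g = z /\ B g = b].
Proof.
move=> d_gt1 e_prim; have [rot [refl [rotM reflM inj surj]]] := dihedral_coordinates d_gt1.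
have ed := prim_expr_order e_prim; have e0 := prim_root_neq0 e_prim.
exists (fun g => e ^+ rot g), refl; split=> [g|g h|g h eq_z eq_b|z b zd].
- by rewrite exprAC ed expr1n.
- split=> //; rewrite -(expr_mod _ ed) rotM expr_mod // exprD; case: (refl g) => //.
  by rewrite expfB_cond ?ed ?mul1r // (negPf e0) add0n ltnW.
- apply: inj; rewrite eq_b; congr (_, _); apply: val_inj.
  move/eqP: eq_z; rewrite (eq_prim_root_expr e_prim) !modn_small // => /eqP.
  exact.
- have [i zE] := prim_rootP e_prim zd; have [g [gi gb]] := surj i b.
  by exists g; rewrite zE gi.
Qed.

Section Deck.
Variables (k : closedFieldType) (d a : nat) (e : k).
Hypotheses (e_prim : d.-primitive_root e) (a_d : coprime a d) (d_gt1 : (1 < d)%N).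
Hypotheses (a_lt_d : (a < d)%N) (two_neq0 : 2%:R != 0 :> k).

Let F := in_tuple (B2d d a e).
Let homF i : tnth F i \is (2 * d).-homog.
Proof. by apply/(B2d_homog e_prim a_d d_gt1 a_lt_d)/mem_tnth. Qed.

Variables (phi : proj_space k 3 -> proj_space k (size (B2d d a e))).
Hypothesis phiP : morphism_of_forms F phi.

Variables (Z : 'D_(2 * d) -> k) (B : 'D_(2 * d) -> bool).
Hypothesis Zd : forall g, Z g ^+ d = 1.
Hypothesis ZBM : forall g h, Z (g * h)%g = Z g * (if B g then (Z h)^-1 else Z h) /\
                  B (g * h)%g = B g (+) B h.
Hypothesis ZB_inj : forall g h, Z g = Z h -> B g = B h -> g = h.
Hypothesis ZB_surj : forall z b, z ^+ d = 1 -> exists g, Z g = z /\ B g = b.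

Let act_neq0 g (v : 'rV[k]_3) : v != 0 -> eval_forms (dih_forms (Z g) (B g)) v != 0.
Proof. by rewrite eval_dih_forms; apply/dih_neq0/(root_neq0 d_gt1). Qed.

Definition dih_map g : proj_space k 3 -> proj_space k 3 := map_of_forms (act_neq0 g).

Lemma dih_mapP g : morphism_of_forms (dih_forms (Z g) (B g)) (dih_map g).
Proof. exact/map_of_formsP/dih_forms_homog. Qed.

Lemma val_dih_map g (p : proj_space k 3) (v : 'rV[k]_3) : v \in val p -> v != 0 ->
  val (dih_map g p) = <[dih (Z g) (B g) v]>%VS.
Proof. by move=> vp v0; rewrite (dih_mapP g vp v0) eval_dih_forms. Qed.

Lemma dih_mapM g h p : dih_map (g * h)%g p = dih_map g (dih_map h p).
Proof.
have vp := memv_pick (val p); have v0 := proj_nonzero p.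
apply: val_inj; rewrite (val_dih_map _ vp v0).
rewrite (val_dih_map g (v := dih (Z h) (B h) (vpick (val p)))); last 2 first.
- by rewrite (val_dih_map _ vp v0) memv_line.
- by apply: dih_neq0 => //; apply: (root_neq0 d_gt1).
by rewrite dihM; have [-> ->] := ZBM g h.
Qed.

Lemma dih_map1 p : dih_map 1%g p = p.
Proof.
have vp := memv_pick (val p); have v0 := proj_nonzero p.
have [Z11 B11] := ZBM 1%g 1%g; rewrite mulg1 in Z11 B11.
have B1 : B 1%g = false by move: B11; rewrite addbb.
have Z1 : Z 1%g = 1.
  apply: (mulfI (root_neq0 d_gt1 (Zd 1%g))).
  by rewrite mulr1 [RHS]Z11 B1.
by apply: val_inj; rewrite (val_dih_map _ vp v0) Z1 B1 dih_id -(proj_line vp v0).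
Qed.

Lemma phi_dih_map g p : phi (dih_map g p) = phi p.
Proof.
have vp := memv_pick (val p); have v0 := proj_nonzero p.
have w0 : dih (Z g) (B g) (vpick (val p)) != 0.
  by apply: dih_neq0 => //; apply: (root_neq0 d_gt1).
apply: val_inj; rewrite (phiP vp v0) (phiP (v := dih (Z g) (B g) (vpick (val p)))) //.
  congr <[_]>%VS; apply/rowP => i; rewrite !eval_formsE.
  exact: (B2d_dih e_prim a_d d_gt1 a_lt_d _ _ (Zd g) (mem_tnth i F)).
by rewrite (val_dih_map _ vp v0) memv_line.
Qed.

Lemma dih_map_deck g : deck_automorphism phi (dih_map g).
Proof.
have reg h : regular_map (dih_map h).
  exact: regular_morphism_of_forms (dih_forms_homog _ _) (dih_mapP h).
split; last by move=> p; apply: phi_dih_map.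
split=> //; exists (dih_map g^-1%g) => //.
by split=> p; rewrite -dih_mapM ?mulVg ?mulgV dih_map1.
Qed.

(** The values of the generators at representatives of [p] and [q] differ by a
    scalar; scaling the representative of [p] by a [2 d]-th root of that scalar
    makes the values equal. *)
Lemma fibre_orbit p q : phi p = phi q -> exists g, q = dih_map g p.
Proof.
move=> eq_phi; pose v := vpick (val p); pose w := vpick (val q).
have vp : v \in val p := memv_pick _; have v0 : v != 0 := proj_nonzero p.
have wq : w \in val q := memv_pick _; have w0 : w != 0 := proj_nonzero q.
have Fv0 := morphism_of_forms_neq0 phiP v0; have Fw0 := morphism_of_forms_neq0 phiP w0.
have /eqP/(vline_eqP Fv0 Fw0)[c c0 FwE] : <[eval_forms F v]>%VS = <[eval_forms F w]>%VS.
  by rewrite -(phiP vp v0) -(phiP wq w0) eq_phi.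
have d2_gt0 : (0 < 2 * d)%N by rewrite muln_gt0 /= ltnW.
have [s sE] := closed_nthroot c d2_gt0.
have s0 : s != 0 by move: c0; rewrite -sE expf_eq0 d2_gt0.
have [f|z [b [t [zd t0 wE]]]] :=
    B2d_separates e_prim a_d d_gt1 a_lt_d two_neq0 (x := s *: v) (y := w).
  case/(tnthP F) => i ->; rewrite -!eval_formsE FwE (eval_forms_scale _ _ homF) sE //.
have [g [gz gb]] := ZB_surj b zd; exists g; apply: val_inj.
rewrite (val_dih_map g vp v0) gz gb (proj_line wq w0) wE dih_scale.
by rewrite !vline_scale.
Qed.

(** The orbit of [(1 : 1 : 0)] is free. *)
Lemma dih_map_inj g h : dih_map g =1 dih_map h -> g = h.
Proof.
move=> eq_gh; pose v : 'rV[k]_3 := \row_i [:: 1; 1; 0]`_i.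
have v0 : v != 0 by apply/rV0Pn; exists 0; rewrite mxE oner_neq0.
have := congr1 val (eq_gh (proj_point v0)).
rewrite !(val_dih_map _ (mem_proj_point v0) v0).
have Zg0 := root_neq0 d_gt1 (Zd g); have Zh0 := root_neq0 d_gt1 (Zd h).
move/(vline_minorsP (dih_neq0 _ Zg0 v0) (dih_neq0 _ Zh0 v0)) => minors.
have := minors 0 1; have := minors 0 2; rewrite !dihE !mxE /= !mul1r !mulr1.
case Bg: (B g); case Bh: (B h); rewrite /= ?mulr1 ?mulr0 => E2 E1.
- by apply: ZB_inj; rewrite ?Bg ?Bh //; apply/esym/invr_inj.
- by move/eqP: E1; rewrite (negPf Zh0).
- by move/eqP: E1; rewrite eq_sym (negPf Zg0).
- by apply: ZB_inj; rewrite ?Bg ?Bh.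
Qed.

(** A point and its image lie in one fibre, hence in one orbit; irreducibility of
    the plane makes the group element independent of the point. *)
Lemma deck_is_dih_map sigma : deck_automorphism phi sigma ->
  exists g, sigma =1 dih_map g.
Proof.
move=> [[reg_sigma _] phi_sigma].
apply: (regular_map_finite_choice reg_sigma dih_mapP) => p.
by apply: fibre_orbit; apply: esym (phi_sigma p).
Qed.

End Deck.

Theorem proposition4p2 (k : closedFieldType) (hk : [pchar k] =i pred0)
  (d a : nat) (hd : (3 <= d)%N) (ha0 : (0 < a)%N) (had : (2 * a < d)%N)
  (hgcd : coprime a d)
  (eps : k) (heps : (2 * d).-primitive_root eps) :
  GT_system (2 * d) (in_tuple (B2d d a (eps ^+ 2))) 'D_((2 * d)%N)%G.
Proof.
set e := eps ^+ 2; have d_gt1 : (1 < d)%N by lia.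
have a_lt_d : (a < d)%N by lia.
have two_neq0 : 2%:R != 0 :> k by apply: (prim_root_dvd_eq0 heps); apply: dvdn_mulr.
have e_prim : d.-primitive_root e.
  have := dvdn_prim_root heps (dvdn_mull 2 (dvdnn d)).
  by rewrite mulnK // ltnW.
have homF i : tnth (in_tuple (B2d d a e)) i \is (2 * d).-homog.
  exact/(B2d_homog e_prim hgcd d_gt1 a_lt_d)/mem_tnth.
have Imon := B2d_large_monomials e_prim hgcd d_gt1 a_lt_d.
have size_le : (size (B2d d a e) <= 'C(2 + 2 * d - 1, 2 - 1))%N.
  rewrite (_ : 2 + 2 * d - 1 = 2 * d + 1)%N ?bin1 ?(size_B2d e_prim) //; lia.
have d2_gt0 : (0 < 2 * d)%N by rewrite muln_gt0 /= ltnW.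
split.
  split=> //; first exact: artinian_of_monomials Imon.
  apply: fails_WLP_of_relations => // L hL L0.
  exact: (relation_linear_form e_prim).
pose phi := map_of_forms (no_common_zero_of_monomials Imon).
have phiP : morphism_of_forms (in_tuple (B2d d a e)) phi := map_of_formsP homF _.
have [Z [B [Zd ZBM ZB_inj ZB_surj]]] := dihedral_root_coordinates d_gt1 e_prim.
have deck := dih_map_deck e_prim hgcd d_gt1 a_lt_d phiP Zd ZBM.
exists phi; split=> //.
- by apply: (finite_morphism_of_monomials _ _ Imon).
- move=> p q /(fibre_orbit e_prim hgcd d_gt1 a_lt_d two_neq0 phiP Zd ZB_surj)[g qE].
  by exists (dih_map d_gt1 B Zd g).
exists (dih_map d_gt1 B Zd); split=> [g _|g h _ _ p|g h _ _|sigma deck_sigma].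
- exact: deck.
- exact: dih_mapM.
- exact: dih_map_inj.
- have [g sE] := deck_is_dih_map e_prim hgcd d_gt1 a_lt_d two_neq0 phiP Zd ZB_surj
    deck_sigma.
  by exists g; rewrite ?inE.
Qed.
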